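(* Let $p,q\ge 1$, $n=p+q$, $G=\mathrm{GL}_n(\mathbb C)$, and $K=\mathrm{GL}_p(\mathbb C)\times \mathrm{GL}_q(\mathbb C)\subset G$ embedded block-diagonally. Let $P\subset \mathrm{GL}_n$, $Q_1\subset \mathrm{GL}_p$, $Q_2\subset \mathrm{GL}_q$ be parabolic subgroups, let $(c_1,\dots,c_{|P|})$ be the composition of $n$ attached to $P$, and let $Q=Q_1\times Q_2$. The double flag variety $\mathfrak X=\mathrm{GL}_p/Q_1\times \mathrm{GL}_q/Q_2\times \mathrm{GL}_n/P$ is of finite type (i.e. has finitely many orbits under the diagonal action of $K$) if and only if, up to switching $(\mathrm{GL}_p,Q_1)$ and $(\mathrm{GL}_q,Q_2)$, one of the following holds: (PA-1) $P$ is arbitrary, and $Q=K$ or $Q$ is mirabolic; (PA-2) $P$ is arbitrary, $Q_1$ is arbitrary, and $Q_2=\mathrm{GL}_q=\mathrm{GL}_1$; (PA-3) $P$ is arbitrary, $Q_1$ is maximal, and $Q_2=\mathrm{GL}_q=\mathrm{GL}_2$; (P6) $|P|\le 6$, $Q_1$ is maximal, and $Q_2=\mathrm{GL}_q$; (P4-1) $|P|\le 4$, $|Q_1|\le 4$, and $Q_2=\mathrm{GL}_q$; (P4-2) $|P|\le 4$ and $\min_i c_i=1$, $Q_1$ is arbitrary, and $Q_2=\mathrm{GL}_q$; (P4-3) $|P|\le 4$, $Q_1$ is arbitrary, and $Q_2=\mathrm{GL}_q=\mathrm{GL}_2$; (P3-1) $|P|\le 3$ and $\min_i c_i=1$, and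 $Q_1,Q_2$ are arbitrary; (P3-2) $|P|\le 3$ and $\min_i c_i=2$, $Q_1$ is arbitrary, and $|Q_2|\le 2$; (P3-3) $|P|\le 3$, $Q_1$ is arbitrary, and $Q_2=\mathrm{GL}_q$ or $Q_2$ is mirabolic; (P3-4) $|P|\le 3$, $|Q_1|\le 4$, and $Q_2$ is maximal; (P2) $|P|\le 2$ (that is, $P=\mathrm{GL}_n$ or $P$ is maximal), and $Q_1,Q_2$ are arbitrary.
   Context: All groups are over $\mathbb C$. A parabolic subgroup $R$ of $\mathrm{GL}_m$ is the stabilizer of a partial flag $0=F_0\subsetneq F_1\subsetneq\cdots\subsetneq F_\ell=\mathbb C^m$; the attached composition of $m$ is $(c_1,\dots,c_\ell)$ with $c_i=\dim F_i/F_{i-1}\ge1$, and $|R|:=\ell$ is the number of its parts. Thus $|R|=1$ means $R=\mathrm{GL}_m$, and $|R|=2$ means that $R$ is a maximal (proper) parabolic subgroup. A parabolic subgroup of $\mathrm{GL}_m$ is called mirabolic if $|R|=2$ and one of the two parts of its composition equals $1$ (stabilizer of a line or of a hyperplane). $Q=Q_1\times Q_2$ is called mirabolic if one of the two factors is mirabolic and the other one is the full general linear group. *)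

(* Defs.v *)
From mathcomp Require Import all_boot all_order all_algebra.
From mathcomp Require Import complex.
From mathcomp Require Import boolp classical_sets cardinality reals.

Set Implicit Arguments.
Unset Strict Implicit.
Unset Printing Implicit Defensive.

Import GRing.Theory.
Local Open Scope classical_set_scope.
Local Open Scope ring_scope.

Section Parabolics.
Variables (F : fieldType) (m : nat).
Implicit Types (U V : {vspace 'cV[F]_m}) (g h : 'M[F]_m).

Definition GL : set 'M[F]_m := [set g | g \in unitmx].

Definition strict_subspace : rel {vspace 'cV[F]_m} :=
  [rel U V | (U <= V)%VS && (U != V)].

(* [:: F_1; ...; F_l] encodes the flag 0 = F_0 < F_1 < ... < F_l = F^m; the
   trivial step F_0 is left implicit, so that the size of the sequence is l. *)
Definition is_flag (s : seq {vspace 'cV[F]_m}) : bool :=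
  path strict_subspace 0%VS s && (last 0%VS s == fullv).

(* A parabolic subgroup of GL_m is recorded by the flag it stabilizes (which
   it determines); the subgroup itself is [stab R]. *)
Record parabolic : Type := Parabolic {
  flag_of : seq {vspace 'cV[F]_m};
  flag_ofP : is_flag flag_of }.

Definition stab (R : parabolic) : set 'M[F]_m :=
  [set g | GL g /\
    forall U, U \in flag_of R -> (linfun (mulmx g : 'cV_m -> 'cV_m) @: U)%VS = U].

Definition composition (R : parabolic) : seq nat :=
  pairmap (fun U V => \dim V - \dim U)%N 0%VS (flag_of R).

Definition nparts (R : parabolic) : nat := size (composition R).

Definition min_part (R : parabolic) : nat :=
  \big[minn/head 0%N (composition R)]_(c <- composition R) c.

Definition maximal_parabolic (R : parabolic) : Prop := nparts R = 2%N.

Definition mirabolic (R : parabolic) : Prop :=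
  nparts R = 2%N /\ 1%N \in composition R.

Definition ltrans g (A : set 'M[F]_m) : set 'M[F]_m := [set g *m h | h in A].

(* GL_m / R, as the set of left cosets. *)
Definition flag_variety (R : parabolic) : set (set 'M[F]_m) :=
  [set ltrans g (stab R) | g in GL].

End Parabolics.

Arguments GL {F} m.

Section DoubleFlagVariety.
Variables (F : fieldType) (p q : nat).

Definition Kgroup : set ('M[F]_p * 'M[F]_q) := GL p `*` GL q.

Definition Kembed (k : 'M[F]_p * 'M[F]_q) : 'M[F]_(p + q) :=
  block_mx k.1 0 0 k.2.

Variables (P : parabolic F (p + q)) (Q1 : parabolic F p) (Q2 : parabolic F q).

Definition double_flag_variety :
    set (set 'M[F]_p * set 'M[F]_q * set 'M[F]_(p + q)) :=
  flag_variety Q1 `*` flag_variety Q2 `*` flag_variety P.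

Definition Kact (k : 'M[F]_p * 'M[F]_q)
    (x : set 'M[F]_p * set 'M[F]_q * set 'M[F]_(p + q)) :=
  (ltrans k.1 x.1.1, ltrans k.2 x.1.2, ltrans (Kembed k) x.2).

Definition Korbit (x : set 'M[F]_p * set 'M[F]_q * set 'M[F]_(p + q)) :=
  [set Kact k x | k in Kgroup].

Definition finite_type : Prop :=
  finite_set [set Korbit x | x in double_flag_variety].

End DoubleFlagVariety.

Arguments Kgroup {F} p q.

Section Classification.
Variable F : fieldType.

Definition mirabolic_pair (p q : nat)
    (Q1 : parabolic F p) (Q2 : parabolic F q) : Prop :=
  (mirabolic Q1 /\ stab Q2 = GL q) \/ (stab Q1 = GL p /\ mirabolic Q2).

(* The size n of P is a separate parameter so that the list can be used both
   for (Q1, Q2) and for (Q2, Q1), p + q and q + p not being convertible. *)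
Variant classified (n p q : nat)
    (P : parabolic F n) (Q1 : parabolic F p) (Q2 : parabolic F q) : Prop :=
| PA_1 of stab Q1 `*` stab Q2 = Kgroup p q \/ mirabolic_pair Q1 Q2
| PA_2 of stab Q2 = GL q & q = 1%N
| PA_3 of maximal_parabolic Q1 & stab Q2 = GL q & q = 2%N
| P6 of (nparts P <= 6)%N & maximal_parabolic Q1 & stab Q2 = GL q
| P4_1 of (nparts P <= 4)%N & (nparts Q1 <= 4)%N & stab Q2 = GL q
| P4_2 of (nparts P <= 4)%N & min_part P = 1%N & stab Q2 = GL q
| P4_3 of (nparts P <= 4)%N & stab Q2 = GL q & q = 2%N
| P3_1 of (nparts P <= 3)%N & min_part P = 1%N
| P3_2 of (nparts P <= 3)%N & min_part P = 2%N & (nparts Q2 <= 2)%N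
| P3_3 of (nparts P <= 3)%N & stab Q2 = GL q \/ mirabolic Q2
| P3_4 of (nparts P <= 3)%N & (nparts Q1 <= 4)%N & maximal_parabolic Q2
| P2 of (nparts P <= 2)%N.

End Classification.

(* Main.v *)
From HB Require Import structures.
Require Import Defs.
From mathcomp Require Import all_boot all_order all_algebra.
From mathcomp Require Import complex.
From mathcomp Require Import boolp classical_sets cardinality reals.
From mathcomp Require Import zify.

(** In bases adapted to the three flags, K-orbits become the double cosets of GL_n by
    block-triangular groups: g ~ h iff x g = h y with x preserving two chains of rows and
    y one chain of columns.  The pairs (x, y) with x g = h y are the morphisms of a Krull-Schmidt
    category whose Tits form on dimension vectors (a, b, c), with p = sum a, q = sum b
    and p + q = sum c, is (sum a_i^2 + sum b_j^2 + sum c_k^2) / 2 - p q.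

    If the form is positive on every nonzero sub-vector, an indecomposable object is a brick
    (Ringel's argument: a non-brick would contain an indecomposable proper subobject with
    self-extensions), hence has no self-extensions, hence is determined by its dimension vector:
    two such objects are both isomorphic to the generic point of the line joining them.  So there
    are finitely many classes.  If the form is nonpositive somewhere, a generic line of matrices
    meets each class finitely often, because its direction is never tangent to a class; and
    one-dimensional summands cancel, so infinitely many classes for a sub-vector give infinitely
    many for the vector itself.

    The listed cases are those where the form is positive on all sub-vectors; every other triple
    contains one of the six vectors (1^2, 1^2, 1^4), (1^3, 1^3, 2^3), (1^3, 2, 1^5),
    (1^5, 2^2, 3^3), (1^5, 3, 2^4), (2^2, 3, 1^7), up to exchanging a and b, on which it vanishes. *)

(** The linear map (x, y) -> x g - h y on flag-preserving pairs, encoded as [delta g h], governs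
    both directions: its kernel is Hom(g, h), its cokernel plays the role of Ext^1, and for h = g
    its image is the tangent space of the class of g. By rank-nullity dim Hom - dim Ext^1 is the
    constant [npat r + npat c - n * n]. A chain of total size p with blocks a_i contributes (p^2 +
    sum a_i^2) / 2 to [npat], and (p^2 + q^2 + n^2) / 2 - n^2 = - p q, which explains the product in
    the Tits form. Arguments on orbit dimensions are run along a line of matrices: rank is
    semicontinuous in the parameter, and a kernel vector at a point of generically maximal rank
    extends to a polynomial one ([lift_ker]). Differentiating such an extension of the identity puts
    a direction in a tangent space; its determinants show that a rigid object is generic on every
    line through it. *)

Set Implicit Arguments.
Unset Strict Implicit.
Unset Printing Implicit Defensive.

Import Order.TTheory GRing.Theory.
Local Open Scope ring_scope.

(** * Block-triangular matrices *)

(* The label of a basis vector records the summand of V = V_1 + V_2 containing it (the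
   boolean) and its step in the flag of that summand; [pat] consists of the matrices of the
   flag-preserving maps. *)
Definition label := (bool * nat)%type.

Definition lle (a b : label) : bool := (a.1 == b.1) && (a.2 <= b.2)%N.

Lemma lle_refl a : lle a a.
Proof. by rewrite /lle eqxx leqnn. Qed.

Lemma lle_trans b a c : lle a b -> lle b c -> lle a c.
Proof.
by case/andP=> /eqP ab1 ab2 /andP[/eqP bc1 bc2]; rewrite /lle ab1 bc1 eqxx (leq_trans ab2).
Qed.

Section Pattern.
Variable F : fieldType.

Definition pat m n (r : 'I_m -> label) (s : 'I_n -> label) (x : 'M[F]_(m, n)) : Prop :=
  forall i j, x i j != 0 -> lle (r i) (s j).

Section PatTheory.
Variables (m n : nat) (r : 'I_m -> label) (s : 'I_n -> label).
Implicit Types x y : 'M[F]_(m, n).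

Lemma pat0 : pat r s 0.
Proof. by move=> i j; rewrite mxE eqxx. Qed.

Lemma patD x y : pat r s x -> pat r s y -> pat r s (x + y).
Proof.
move=> px py i j; rewrite mxE; case: (eqVneq (x i j) 0) => [->|/px //].
by rewrite add0r; apply: py.
Qed.

Lemma patN x : pat r s x -> pat r s (- x).
Proof. by move=> px i j; rewrite mxE oppr_eq0; apply: px. Qed.

Lemma patB x y : pat r s x -> pat r s y -> pat r s (x - y).
Proof. by move=> px py; apply/patD/patN. Qed.

Lemma patZ a x : pat r s x -> pat r s (a *: x).
Proof. by move=> px i j; rewrite mxE mulf_eq0 negb_or => /andP[_]; apply: px. Qed.

Definition pmask x : 'M[F]_(m, n) := \matrix_(i, j) (x i j *+ lle (r i) (s j)).

Lemma mask_pat x : pat r s (pmask x).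
Proof. by move=> i j; rewrite mxE; case: lle => //; rewrite eqxx. Qed.

Lemma pat_mask x : pat r s x -> pmask x = x.
Proof.
move=> px; apply/matrixP=> i j; rewrite mxE.
by case: (eqVneq (x i j) 0) => [->|/px ->]; rewrite ?mul0rn.
Qed.

Lemma mask_id x : pmask (pmask x) = pmask x.
Proof. exact/pat_mask/mask_pat. Qed.

Fact mask_is_linear : linear pmask.
Proof.
by move=> a x y; apply/matrixP=> i j; rewrite !mxE mulrnDl -mulrnAr.
Qed.
HB.instance Definition _ := GRing.isLinear.Build F _ _ _ pmask mask_is_linear.

End PatTheory.

Lemma patM m n k (r : 'I_m -> label) (s : 'I_n -> label) (t : 'I_k -> label)
    (x : 'M_(m, n)) (y : 'M_(n, k)) : pat r s x -> pat s t y -> pat r t (x *m y).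
Proof.
move=> px py i j; rewrite mxE => nz.
have [l nzl]: exists l, x i l * y l j != 0.
  apply/existsP; apply: contraNT nz => /existsPn z.
  by rewrite big1 // => l _; apply/eqP; rewrite -[_ == 0]negbK z.
by move: nzl; rewrite mulf_eq0 negb_or => /andP[/px + /py]; apply: lle_trans.
Qed.

Lemma pat_scalar n (r : 'I_n -> label) a : pat r r a%:M.
Proof. by move=> i j; rewrite mxE; case: (eqVneq i j) => [-> _|_]; rewrite ?lle_refl ?eqxx. Qed.

Lemma pat_sum m n (r : 'I_m -> label) (s : 'I_n -> label) (I : Type) (l : seq I) (P : pred I)
    (f : I -> 'M[F]_(m, n)) :
  (forall i, P i -> pat r s (f i)) -> pat r s (\sum_(i <- l | P i) f i).
Proof. by move=> pf; elim/big_ind: _ => //; [apply: pat0 | apply: patD]. Qed.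

Lemma pat_horner n (r : 'I_n.+1 -> label) (x : 'M_n.+1) (p : {poly F}) :
  pat r r x -> pat r r (horner_mx x p).
Proof.
move=> px; rewrite -[p]coefK poly_def rmorph_sum /=; apply: pat_sum => i _.
rewrite linearZ rmorphXn /= horner_mx_X; apply: patZ.
elim: (nat_of_ord i) => [|k IH]; first by rewrite expr0; apply: pat_scalar.
by rewrite exprS; apply: (patM px).
Qed.

(** By Cayley-Hamilton the inverse of [x] is a polynomial in [x], and the matrices of pattern
    [pat r r] form an algebra. *)
Lemma pat_inv n (r : 'I_n -> label) (x : 'M_n) :
  x \in unitmx -> pat r r x -> pat r r (invmx x).
Proof.
case: n r x => [|n] r x ux px; first by move=> [].
pose p := char_poly x.
have p0 : p.[0] != 0.
  rewrite horner_coef0 char_poly_det mulf_neq0 ?signr_eq0 //.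
  by move: ux; rewrite unitmxE unitfE.
have /factor_theorem [q pq] : root (p - p.[0]%:P) 0.
  by rewrite /root !hornerE subrr.
have : x *m horner_mx x q = - p.[0] *: 1%:M.
  have := congr1 (horner_mx x) pq; rewrite rmorphM rmorphB /=.
  rewrite Cayley_Hamilton rmorphB /= horner_mx_X !horner_mx_C raddf0 subr0 sub0r.
  move=> E; rewrite scaleNr scalemx1 E.
  exact: (comm_mx_horner _ (comm_mx_refl x)).
move=> E; have -> : invmx x = - (p.[0])^-1 *: horner_mx x q.
  rewrite -[RHS](mulKmx ux) -scalemxAr E scalerA mulrNN mulVf // scale1r.
  by rewrite mulmx1.
by apply/patZ/pat_horner.
Qed.

End Pattern.

Section Kernel.
Variable F : fieldType.

(* A column is dependent when it is a combination of the preceding columns of its own chain;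
   the dependent columns index an adapted basis of the kernel. *)
Lemma kernel_split n (r : 'I_n -> label) (x : 'M[F]_n) : pat r r x ->
  exists (m : nat) (ι : 'I_m -> 'I_n) (s : 'M[F]_(n, m)) (t : 'M[F]_(m, n)),
    [/\ injective ι, pat r (r \o ι) s, pat (r \o ι) r t, t *m s = 1%:M &
     x *m s = 0 /\ forall k (z : 'M[F]_(n, k)), x *m z = 0 -> z = s *m (t *m z)].
Proof.
move=> px.
(* Step of the flag first, index second: since [i < n], this orders each chain totally and refines
   the order of its steps. *)
pose key (i : 'I_n) := ((r i).2 * n + i)%N.
pose b i j := ((r i).1 == (r j).1) && (key i < key j)%N.
have b_lle i j : b i j -> lle (r i) (r j).
  case/andP=> e1; rewrite /lle e1 /=; apply: contraTT; rewrite -ltnNge -leqNgt => lt.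
  rewrite /key; apply: (@leq_trans ((r i).2 * n)); last exact: leq_addr.
  rewrite (@leq_trans ((r j).2.+1 * n)) ?leq_mul2r ?lt ?orbT //.
  by rewrite mulSn addnC leq_add2r ltnW.
have key_inj i j : (r i).1 = (r j).1 -> key i = key j -> i = j.
  move=> _ /(congr1 (modn^~ n)); rewrite /key !modnMDl !modn_small //.
  exact: val_inj.
pose D j := `[< exists w : 'I_n -> F, (forall i, w i != 0 -> b i j) /\
                  forall a, x a j = \sum_i w i * x a i >].
have redW k j : (key j < k)%N -> exists w : 'I_n -> F,
    (forall i, w i != 0 -> ~~ D i /\ lle (r i) (r j)) /\
    forall a, x a j = \sum_i w i * x a i.
  elim: k j => // k IH j; rewrite ltnS => jk.
  case: (boolP (D j)) => [/asboolP[w [wb wx]]|nD]; last first.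
    exists (fun i => (i == j)%:R); split.
      by move=> i; case: (eqVneq i j) => [->|]; rewrite ?lle_refl // eqxx.
    move=> a; rewrite (bigD1 j) //= eqxx mul1r big1 ?addr0 // => i /negbTE ->.
    by rewrite mul0r.
  have /choice [W HW] i : exists w' : 'I_n -> F, w i != 0 ->
    (forall l, w' l != 0 -> ~~ D l /\ lle (r l) (r i)) /\
    forall a, x a i = \sum_l w' l * x a l.
    case: (eqVneq (w i) 0) => [_|/wb bij]; first by exists (fun=> 0).
    have [|w' Hw'] := IH i; last by exists w'.
    by case/andP: bij => _ /leq_trans->.
  exists (fun l => \sum_i w i * W i l); split.
    move=> l nz.
    have [i nzi]: exists i, w i * W i l != 0.
      apply/existsP; apply: contraNT nz => /existsPn z.
      by rewrite big1 // => i _; apply/eqP; rewrite -[_ == 0]negbK z.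
    move: nzi; rewrite mulf_eq0 negb_or => /andP[wi Wil].
    have [/(_ l Wil) [nD li] _] := HW i wi.
    by split=> //; apply: lle_trans li (b_lle _ _ (wb _ wi)).
  move=> a; rewrite wx; under [RHS]eq_bigr do rewrite mulr_suml.
  rewrite exchange_big /=; apply: eq_bigr => i _.
  case: (eqVneq (w i) 0) => [->|/HW[_ ->]].
    by rewrite mul0r big1 // => l _; rewrite !mul0r.
  by rewrite mulr_sumr; apply: eq_bigr => l _; rewrite mulrA.
have /choice [W HW] j := redW _ j (ltnSn _).
have W0 i j : D i -> W j i = 0.
  move=> Di; apply/eqP; apply: contraLR (Di) => /(HW j).1[]//.
pose A := [set j | D j]%SET.
pose ι : 'I_#|A| -> 'I_n := enum_val.
have ιD i : D (ι i) by have := enum_valP i; rewrite inE.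
exists #|A|, ι, (\matrix_(i, j) ((i == ι j)%:R - W (ι j) i)), (\matrix_(i, j) (ι i == j)%:R).
set s := \matrix_(i, j) _; set t := \matrix_(i, j) _.
have tE k (z : 'M[F]_(n, k)) i j : (t *m z) i j = z (ι i) j.
  rewrite mxE (bigD1 (ι i)) //= mxE eqxx mul1r big1 ?addr0 // => l /negbTE nl.
  by rewrite mxE eq_sym nl mul0r.
have xs0 : x *m s = 0.
  apply/matrixP=> a j; rewrite !mxE.
  under eq_bigr do rewrite mxE mulrBr [_ * W _ _]mulrC.
  rewrite sumrB -(HW (ι j)).2 (bigD1 (ι j)) //= eqxx mulr1 big1 ?addr0 ?subrr //.
  by move=> i /negbTE ->; rewrite mulr0.
have ts1 : t *m s = 1%:M.
  apply/matrixP=> i j; rewrite tE !mxE W0 // subr0.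
  by rewrite (inj_eq enum_val_inj).
split=> //; first exact: enum_val_inj.
- move=> i j; rewrite mxE; case: (eqVneq i (ι j)) => [-> _|_]; first exact: lle_refl.
  by rewrite sub0r oppr_eq0 => /(HW (ι j)).1[].
- by move=> i j; rewrite mxE; case: (eqVneq (ι i) j) => [<- _|_]; rewrite ?lle_refl ?eqxx.
split=> // k z xz0.
suff /eqP : z - s *m (t *m z) = 0 by rewrite subr_eq0 => /eqP.
set u := z - _.
have xu0 : x *m u = 0 by rewrite mulmxBr xz0 mulmxA xs0 mul0mx subr0.
have uD i c : D i -> u i c = 0.
  move=> Di; have Ai : i \in A by rewrite inE.
  have -> : i = ι (enum_rank_in Ai i) by rewrite /ι enum_rankK_in.
  by rewrite -tE mulmxBr mulmxA ts1 mul1mx subrr mxE.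
clearbody u.
apply/matrixP=> i c; rewrite [RHS]mxE; apply/eqP; apply: contraT => ui.
(* At the last nonzero coordinate of [u] in the chain of [i], solving [x *m u = 0] for the
   corresponding column makes that column dependent, whereas [u] vanishes at dependent indices.
   Other chains drop out because [x] maps each chain to itself. *)
pose Q j := (u j c != 0) && ((r j).1 == (r i).1).
have Qi : Q i by rewrite /Q ui eqxx.
case: (arg_maxnP key Qi) => j /andP[uj sj] maxj.
suff: D j by move=> /(uD j c)/eqP; rewrite (negbTE uj).
apply/asboolP; exists (fun l => if Q l && (l != j) then - (u l c / u j c) else 0); split.
  move=> l; case: ifP; rewrite ?eqxx // => /andP[Ql lj] _.
  have sl : (r l).1 == (r j).1 by case/andP: Ql => _ /eqP->; rewrite (eqP sj).
  rewrite /b sl ltn_neqAle (maxj l Ql : (key l <= key j)%N) andbT.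
  by apply: contra lj => /eqP/key_inj-> //; apply/eqP.
move=> a; apply: (mulIf uj); rewrite mulr_suml.
case: (boolP ((r a).1 == (r i).1)) => sa; last first.
  have xa0 l : (r l).1 == (r i).1 -> x a l = 0.
    move=> sl; apply/eqP; apply: contraNT sa => /px /andP[/eqP-> _] //.
  rewrite xa0 // mul0r big1 // => l _; case: ifP; last by rewrite /= !mul0r.
  by case/andP=> /andP[_ /xa0->] _; rewrite mulr0 mul0r.
rewrite /=; move/matrixP/(_ a c): xu0; rewrite !mxE (bigD1 j) //=.
move/eqP; rewrite addr_eq0 => /eqP->; rewrite [RHS](bigD1 j) //= eqxx andbF !mul0r add0r.
rewrite -sumrN; apply: eq_bigr => l lj; rewrite lj andbT /Q.
case: (eqVneq (u l c) 0) => [->|ul] /=; first by rewrite mulr0 !mul0r oppr0.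
case: eqP => [_|sl]; first by rewrite !mulNr mulrAC divfK // mulrC.
suff -> : x a l = 0 by rewrite mul0r oppr0 !mul0r.
apply/eqP; apply: contra_notT sl => /px /andP[/eqP <- _]; exact/eqP.
Qed.
End Kernel.

(** * Polynomial families of matrices *)

Section PolynomialMatrices.
Variable F : fieldType.

(** Zariski density in the affine line, that is, infinitude of [S]. *)
Definition dense (S : F -> Prop) : Prop :=
  forall p : {poly F}, (forall t, S t -> p.[t] = 0) -> p = 0.

Definition evmx m n (t : F) (M : 'M[{poly F}]_(m, n)) : 'M[F]_(m, n) :=
  map_mx (horner_eval t) M.

Lemma evmxM m n k t (M : 'M_(m, n)) (N : 'M_(n, k)) :
  evmx t (M *m N) = evmx t M *m evmx t N.
Proof. exact: map_mxM. Qed.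

Lemma evmxC m n t (A : 'M[F]_(m, n)) : evmx t (map_mx polyC A) = A.
Proof. by apply/matrixP=> i j; rewrite !mxE /= /horner_eval hornerC. Qed.

Lemma evmx_det n t (M : 'M_n) : \det (evmx t M) = (\det M).[t].
Proof. by rewrite /evmx det_map_mx. Qed.

Lemma rank_unit_minor m n (A : 'M[F]_(m, n)) :
  exists (U : 'M_(\rank A, m)) (W : 'M_(n, \rank A)), U *m A *m W = 1%:M.
Proof.
have /row_fullP[U HU] := col_base_full A; have /row_freeP[W HW] := row_base_free A.
exists U, W; have := congr1 (fun B => U *m B *m W) (mulmx_base A).
by rewrite mulmxA HU mul1mx HW => <-.
Qed.

Lemma rank_unit_le m n r (A : 'M[F]_(m, n)) (U : 'M_(r, m)) (W : 'M_(n, r)) :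
  U *m A *m W \in unitmx -> (r <= \rank A)%N.
Proof.
move=> /mxrank_unit <-; apply: leq_trans (mxrankM_maxl _ _) (mxrankM_maxr _ _).
Qed.

(** Semicontinuity: compressed by [U] and [W] to the identity at [t0], the matrix stays invertible
    away from the zeros of a determinant. *)
Lemma rank_generic m n (M : 'M[{poly F}]_(m, n)) t0 :
  exists p : {poly F}, p.[t0] != 0 /\
    forall t, p.[t] != 0 -> (\rank (evmx t0 M) <= \rank (evmx t M))%N.
Proof.
have [U [W UMW]] := rank_unit_minor (evmx t0 M).
pose B := map_mx polyC U *m M *m map_mx polyC W.
have BE t : evmx t B = U *m evmx t M *m W by rewrite /B !evmxM !evmxC.
exists (\det B); split; first by rewrite -evmx_det BE UMW det1 oner_eq0.
by move=> t; rewrite -evmx_det BE -unitfE -unitmxE => /rank_unit_le.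
Qed.

(* With U M(t0) W = 1 and B = U M W, the vector det(B) z - z M W adj(B) U is killed
   by M W, hence by M wherever the rank of M does not exceed that of M(t0). *)
Lemma lift_ker m n (M : 'M[{poly F}]_(m, n)) (S : F -> Prop) t0 (z : 'rV_m) :
  dense S -> (forall t, S t -> (\rank (evmx t M) <= \rank (evmx t0 M))%N) ->
  z *m evmx t0 M = 0 -> exists Z : 'rV_m, Z *m M = 0 /\ evmx t0 Z = z.
Proof.
move=> dS rS z0.
have [U [W UMW]] := rank_unit_minor (evmx t0 M).
pose U' := map_mx polyC U; pose W' := map_mx polyC W; pose z' := map_mx polyC z.
pose B := U' *m M *m W'.
have BE t : evmx t B = U *m evmx t M *m W by rewrite /B !evmxM !evmxC.
have detB0 : \det B != 0.
  apply/eqP=> /(congr1 (horner^~ t0))/eqP.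
  by rewrite -evmx_det BE UMW det1 horner0 oner_eq0.
pose Z := \det B *: z' - z' *m M *m W' *m \adj B *m U'.
have ZMW : Z *m M *m W' = 0.
  have -> : Z *m M *m W' = \det B *: (z' *m M *m W') - z' *m M *m W' *m (\adj B *m B).
    by rewrite /Z !mulmxBl -!scalemxAl /B !mulmxA.
  by rewrite mul_adj_mx mul_mx_scalar subrr.
exists Z; split; last first.
  rewrite /Z /evmx map_mxB map_mxZ !map_mxM -!/(evmx t0 _) !evmxC.
  by rewrite z0 !mul0mx subr0 /= /horner_eval -evmx_det BE UMW det1 scale1r.
apply/matrixP=> i j; rewrite [RHS]mxE; apply: (mulfI detB0); rewrite mulr0.
apply: dS => t St; rewrite hornerM -evmx_det.
case: (eqVneq (\det (evmx t B)) 0) => [->|nz]; first by rewrite mul0r.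
suff /matrixP/(_ i j) : evmx t (Z *m M) = 0.
  by rewrite !mxE /= /horner_eval => ->; rewrite mulr0.
have uB : U *m evmx t M *m W \in unitmx by rewrite -BE unitmxE unitfE.
(* The rank of M(t) is at most that of M(t0), which M(t) W already attains. So the columns of M(t)
   are combinations of those of M(t) W, and Z(t) M(t) W = 0 yields Z(t) M(t) = 0. *)
have rW : (\rank (evmx t M) <= \rank (evmx t M *m W))%N.
  apply: leq_trans (rS t St) _.
  rewrite -{1}(mxrank_unit uB) -mulmxA; exact: mxrankM_maxr.
have [C HC] : exists C, evmx t M = evmx t M *m W *m C.
  have : ((evmx t M)^T <= (evmx t M *m W)^T)%MS.
    rewrite -mxrank_leqif_sup; last by rewrite trmx_mul submxMl.
    by rewrite !mxrank_tr eqn_leq rW mxrankM_maxl.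
  by case/submxP=> D /(congr1 trmx); rewrite [in RHS]trmx_mul !trmxK => E; exists D^T.
rewrite evmxM HC; have := congr1 (evmx t) ZMW; rewrite !evmxM evmxC.
by rewrite !mulmxA => ->; rewrite /evmx map_mx0 mul0mx.
Qed.

End PolynomialMatrices.

Section InfiniteField.
Variable F : closedFieldType.

Lemma poly_nonroot (p : {poly F}) : p != 0 -> exists t, p.[t] != 0.
Proof.
move=> p0; case: (ltnP 1 (size p)) => sp; last first.
  by exists 0; rewrite (size1_polyC sp) hornerC; move: p0; rewrite {1}(size1_polyC sp) polyC_eq0.
have : size (p - 1) != 1%N.
  by rewrite size_polyDl ?size_polyN ?size_poly1 // neq_ltn sp orbT.
case/closed_rootP=> t; rewrite /root !hornerE subr_eq0 => /eqP pt.
by exists t; rewrite pt oner_eq0.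
Qed.

Lemma dense_nonroot (p : {poly F}) : p != 0 -> dense (fun t => p.[t] != 0).
Proof.
move=> p0 q qS; apply/eqP; apply: contraT => q0.
have [t] := poly_nonroot (mulf_neq0 p0 q0).
by rewrite hornerM mulf_eq0 negb_or => /andP[/qS->]; rewrite eqxx.
Qed.

(** Irreducibility of the line: nonzero polynomials vanishing on the fibres of [c] would have a
    nonzero product vanishing on [S]. *)
Lemma dense_pigeonhole (K : finType) (S : F -> Prop) (c : F -> K) :
  dense S -> exists k, dense (fun t => S t /\ c t = k).
Proof.
move=> dS; apply: contrapT => nex.
have /choice [p Hp] k : exists p : {poly F},
    p != 0 /\ forall t, S t -> c t = k -> p.[t] = 0.
  apply: contrapT => np; apply: nex; exists k => p pS; apply/eqP; apply: contraT => p0.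
  by case: np; exists p; split=> // t St ct; apply: pS.
have : \prod_k p k = 0.
  apply: dS => t St; rewrite horner_prod (bigD1 (c t)) //= (Hp _).2 // mul0r //.
by apply/eqP/prodf_neq0 => k _; case: (Hp k).
Qed.

End InfiniteField.

(** * The Tits form and infinite families *)

(* The dimension of the space of flag-preserving endomorphisms; the Tits form of a pair of
   labellings is [npat r + npat c - n * n]. *)
Definition npat n (r : 'I_n -> label) : nat := #|[set ij | lle (r ij.1) (r ij.2)]|.

Section MaskRank.
Variable F : fieldType.

Lemma rank_mask n (r : 'I_n -> label) : \rank (lin_mx (pmask (F := F) r r)) = npat r.
Proof.
pose A := [set k | (mxvec (\matrix_(i, j) (lle (r i) (r j))%:R) : 'rV[F]_(n * n)) 0 k != 0]%SET.
have AE i j : (mxvec_index i j \in A) = lle (r i) (r j).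
  by rewrite inE mxvecE mxE; case: lle; rewrite ?oner_eq0 ?eqxx.
have <- : #|A| = npat r.
  rewrite /npat -(card_in_imset (f := uncurry (@mxvec_index n n))).
    apply: eq_card => k; case/mxvec_indexP: k => i j; rewrite AE.
    apply/idP/imsetP => [lij|[[i' j']]]; first by exists (i, j); rewrite ?inE.
    by rewrite inE /= => l' /cast_ord_inj/enum_rank_inj[-> ->].
  by case=> i j [i' j'] _ _ /= /cast_ord_inj/enum_rank_inj.
pose U : 'M[F]_(#|A|, n * n) := \matrix_(i, j) (enum_val i == j)%:R.
have UU : U *m U^T = 1%:M.
  apply/matrixP=> i j; rewrite mxE (bigD1 (enum_val i)) //= !mxE eqxx mul1r big1 => [|k nk].
    by rewrite addr0 (inj_eq enum_val_inj) eq_sym.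
  by rewrite !mxE eq_sym (negbTE nk) mul0r.
have -> : lin_mx (pmask r r) = U^T *m U.
  apply/matrixP=> k l; rewrite mxE.
  have -> : (mxvec \o pmask r r \o vec_mx) (delta_mx 0 k) 0 l = ((k == l) && (k \in A))%:R :> F.
    case/mxvec_indexP: k => i j; rewrite /= vec_mx_delta AE.
    have -> : pmask (F := F) r r (delta_mx i j) = (lle (r i) (r j))%:R *: delta_mx i j.
      apply/matrixP=> a b; rewrite !mxE; case: eqP => [->|_] /=; last by rewrite mul0rn mulr0.
      by case: eqP => [->|_]; rewrite ?mulr1 ?mulr0 ?mul0rn.
    rewrite linearZ /= mxvec_delta !mxE eqxx /= eq_sym.
    by case: eqP; case: lle; rewrite ?mulr0 ?mulr1.
  rewrite mxE; case: (boolP (k \in A)) => [Ak|nAk].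
    rewrite andbT (bigD1 (enum_rank_in Ak k)) //= !mxE enum_rankK_in // eqxx mul1r.
    rewrite big1 ?addr0 // => i /eqP ni; rewrite !mxE.
    case: eqP => [E|_]; last by rewrite mul0r.
    by case: ni; apply: enum_val_inj; rewrite enum_rankK_in.
  rewrite andbF big1 // => i _; rewrite !mxE; case: eqP => [E|_]; last by rewrite mul0r.
  by rewrite -E enum_valP in nAk.
apply/eqP; rewrite eqn_leq; apply/andP; split.
  by apply: leq_trans (mxrankM_maxr _ _) (rank_leq_row _).
by apply: (@rank_unit_le _ _ _ _ _ U U^T); rewrite mulmxA UU mul1mx UU unitmx1.
Qed.

End MaskRank.

Section Delta.
Variables (F : fieldType) (n : nat) (r c : 'I_n -> label).
Implicit Types (g h x y : 'M[F]_n).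

Definition delta1 g : 'M[F]_(n * n) := lin_mx (mulmxr g \o pmask r r).
Definition delta2 h : 'M[F]_(n * n) := lin_mx (mulmx h \o pmask c c).
Definition delta g h : 'M[F]_(n * n + n * n, n * n) := col_mx (delta1 g) (- delta2 h).

Lemma deltaE g h x y :
  row_mx (mxvec x) (mxvec y) *m delta g h = mxvec (pmask r r x *m g - h *m pmask c c y).
Proof. by rewrite mul_row_col mulmxN !mul_vec_lin linearB. Qed.

Lemma deltaP g h (v : 'rV_(n * n)) :
  reflect (exists x y, [/\ pat r r x, pat c c y & v = mxvec (x *m g - h *m y)])
          (v <= delta g h)%MS.
Proof.
apply: (iffP submxP) => [[z ->]|[x [y [px py ->]]]]; last first.
  by exists (row_mx (mxvec x) (mxvec y)); rewrite deltaE !pat_mask.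
exists (pmask r r (vec_mx (lsubmx z))), (pmask c c (vec_mx (rsubmx z))).
split; try exact: mask_pat.
by rewrite -deltaE !vec_mxK hsubmxK.
Qed.

(** Projector onto the pairs of patterns [r] and [c]. Entries outside the patterns lie in the kernel
    of [delta] trivially, so the morphisms are that kernel intersected with the image of this
    matrix. *)
Definition maskrc : 'M[F]_(n * n + n * n) :=
  block_mx (lin_mx (pmask r r)) 0 0 (lin_mx (pmask c c)).

Lemma rank_maskrc : \rank maskrc = (npat r + npat c)%N.
Proof. by rewrite rank_diag_block_mx !rank_mask. Qed.

Lemma maskrcE x y :
  row_mx (mxvec x) (mxvec y) *m maskrc = row_mx (mxvec (pmask r r x)) (mxvec (pmask c c y)).
Proof. by rewrite mul_row_block !mulmx0 addr0 add0r !mul_vec_lin. Qed.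

(** The Euler characteristic: dim Hom - dim Ext^1 depends on the labels alone. *)
Lemma rank_delta g h :
  (\rank (delta g h) + \rank (maskrc :&: kermx (delta g h))%MS = npat r + npat c)%N.
Proof.
rewrite -rank_maskrc -(mxrank_mul_ker maskrc (delta g h)); congr (_ + _)%N.
suff {1}-> : delta g h = maskrc *m delta g h by [].
apply/row_matrixP=> i; rewrite !rowE mulmxA.
set z := delta_mx 0 i; have -> : z = row_mx (mxvec (vec_mx (lsubmx z))) (mxvec (vec_mx (rsubmx z))).
  by rewrite !vec_mxK hsubmxK.
by rewrite maskrcE !deltaE !mask_id.
Qed.

Lemma ker_deltaP g h (z : 'rV_(n * n + n * n)) :
  reflect (exists x y, [/\ pat r r x, pat c c y, x *m g = h *m y &
                           z = row_mx (mxvec x) (mxvec y)])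
          (z <= maskrc :&: kermx (delta g h))%MS.
Proof.
rewrite sub_capmx; apply: (iffP andP) => [[/submxP[w ->] /sub_kermxP]|[x [y [px py E ->]]]].
  rewrite -[w]hsubmxK -[lsubmx w]vec_mxK -[rsubmx w]vec_mxK maskrcE deltaE.
  rewrite !mask_id => /(congr1 vec_mx); rewrite mxvecK linear0 => /eqP.
  rewrite subr_eq0 => /eqP E; eexists; eexists; split; last by []; try exact: mask_pat.
  exact: E.
split; last by apply/sub_kermxP; rewrite deltaE !pat_mask // E subrr linear0.
by apply/submxP; exists (row_mx (mxvec x) (mxvec y)); rewrite maskrcE !pat_mask.
Qed.

End Delta.

Section DoubleCosets.
Variables (F : fieldType) (n : nat) (r c : 'I_n -> label).

Definition eqv (g h : 'M[F]_n) : Prop :=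
  exists x y, [/\ pat r r x /\ pat c c y, x \in unitmx, y \in unitmx & x *m g = h *m y].

(** Only separation is asked for: [inv] may take several values on one class, so any finite code
    from which the class can be recovered will do. *)
Definition finitely_many : Prop :=
  exists (K : finType) (inv : 'M[F]_n -> K),
    forall g h, g \in unitmx -> h \in unitmx -> inv g = inv h -> eqv g h.

End DoubleCosets.

Section Infinite.
Variables (F : closedFieldType) (n : nat) (r c : 'I_n -> label).
Implicit Types (g h v w : 'M[F]_n).

Lemma deltaD g h v w t :
  delta r c (g + t *: v) (h + t *: w) = delta r c g h + t *: delta r c v w.
Proof.
apply/row_matrixP=> i; rewrite linearD linearZ /= !rowE.
set z := delta_mx 0 i; have -> : z = row_mx (mxvec (vec_mx (lsubmx z))) (mxvec (vec_mx (rsubmx z))).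
  by rewrite !vec_mxK hsubmxK.
rewrite !deltaE -linearZ -linearD /= mulmxDr mulmxDl -scalemxAr -scalemxAl scalerBr opprD.
by rewrite addrACA.
Qed.

Definition line m k (A B : 'M[F]_(m, k)) : 'M[{poly F}]_(m, k) :=
  map_mx polyC A + 'X *: map_mx polyC B.

Lemma ev_line m k (A B : 'M[F]_(m, k)) t : evmx t (line A B) = A + t *: B.
Proof. by apply/matrixP=> i j; rewrite !mxE /= /horner_eval !hornerE. Qed.

Lemma deriv_mulmx m k l (Z : 'M[{poly F}]_(m, k)) (M : 'M_(k, l)) :
  map_mx deriv (Z *m M) = map_mx deriv Z *m M + Z *m map_mx deriv M.
Proof.
apply/matrixP=> i j; rewrite !mxE raddf_sum -big_split /=; apply: eq_bigr => a _.
by rewrite !mxE derivM.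
Qed.

Lemma deriv_line m k (A B : 'M[F]_(m, k)) : map_mx deriv (line A B) = map_mx polyC B.
Proof. by apply/matrixP=> i j; rewrite !mxE derivD derivC derivM derivX derivC mulr0 mul1r add0r addr0. Qed.

(** The pair of identities is a nonzero endomorphism, so a nonpositive Tits form forces Ext^1 to be
    nonzero: some direction is not tangent to the class. *)
Lemma rank_delta_lt g : (0 < n)%N -> (npat r + npat c <= n * n)%N ->
  (\rank (delta r c g g) < n * n)%N.
Proof.
move=> n0 le; apply: leq_trans le; rewrite -(rank_delta _ _ g g) -addn1 leq_add2l.
rewrite lt0n mxrank_eq0; apply/negP=> /eqP cap0.
have : (row_mx (mxvec 1%:M) (mxvec 1%:M) <= maskrc F r c :&: kermx (delta r c g g))%MS.
  by apply/ker_deltaP; exists 1%:M, 1%:M; rewrite mul1mx mulmx1; split=> //; apply: pat_scalar.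
rewrite cap0 submx0 => /eqP/(congr1 lsubmx); rewrite row_mxKl linear0 => /eqP.
rewrite mxvec_eq0 => /eqP/matrixP/(_ (Ordinal n0) (Ordinal n0))/eqP.
by rewrite !mxE eqxx oner_eq0.
Qed.

(* If x g = h y then left multiplication by x maps the image of delta g g onto that of
   delta g h. *)
Lemma eqv_rank_delta g h : g \in unitmx -> eqv r c g h ->
  (\rank (delta r c g h) <= \rank (delta r c g g))%N.
Proof.
move=> ug [x [y [[px py] ux uy E]]].
apply: (@leq_trans (\rank (delta r c g g *m lin_mx (mulmx x)))); last exact: mxrankM_maxl.
apply: mxrankS; apply/rV_subP=> w /deltaP[a [b [pa pb ->]]].
apply/submxP; exists (row_mx (mxvec (invmx x *m a)) (mxvec (invmx y *m b))).
have pa' : pat r r (invmx x *m a) by apply: patM pa; apply: pat_inv.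
have pb' : pat c c (invmx y *m b) by apply: patM pb; apply: pat_inv.
rewrite mulmxA deltaE mul_vec_lin !pat_mask //= mulmxBr; congr (mxvec (_ - _)).
  by rewrite mulmxA mulKVmx.
by rewrite 2!mulmxA E -!mulmxA mulKVmx.
Qed.

(* Along a generic line g0 + t v, if one class contained densely many points, lifting
   the identity endomorphism polynomially in t and differentiating would show that the
   direction v is tangent to that class, which a generic v is not. *)
Lemma infinite_of_npat : (0 < n)%N -> (npat r + npat c <= n * n)%N ->
  ~ finitely_many F r c.
Proof.
move=> n0 le [K [inv Hinv]].
pose Pk k := `[< exists2 g : 'M[F]_n, g \in unitmx & \rank (delta r c g g) = k >].
have exP : exists k, Pk k by exists (\rank (delta r c (1%:M : 'M[F]_n) 1%:M)); apply/asboolP; exists 1%:M; rewrite ?unitmx1.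
have ubP k : Pk k -> (k <= n * n)%N by case/asboolP=> g _ <-; apply: rank_leq_col.
have [k0 /asboolP[g0 ug0 <-] max0] := ex_maxnP exP ubP.
have {}max0 g : g \in unitmx -> (\rank (delta r c g g) <= \rank (delta r c g0 g0))%N.
  by move=> ug; apply: max0; apply/asboolP; exists g.
have [v Hv] : exists v, ~~ (mxvec v <= delta r c g0 g0)%MS.
  have : ~~ (1%:M <= delta r c g0 g0)%MS.
    by rewrite sub1mx /row_full neq_ltn rank_delta_lt.
  by case/row_subPn=> i Hi; exists (vec_mx (row i 1%:M)); rewrite vec_mxK.
pose g t := g0 + t *: v.
(* Off the zeros of [p2], the tangent space at [g t] together with [v] has rank at least its value
   at [g0], which exceeds the maximal rank of a tangent space; so [v] is still not tangent at
   [g t]. *)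
have [p2 [p20 Hp2]] := rank_generic
  (line (col_mx (delta r c g0 g0) (mxvec v)) (col_mx (delta r c v v) 0)) 0.
pose p1 := \det (line g0 v).
have p1E t : p1.[t] = \det (g t) by rewrite -evmx_det ev_line.
have p12 : p1 * p2 != 0.
  have : (p1 * p2).[0] != 0.
    by rewrite hornerM mulf_neq0 // p1E /g scale0r addr0 -unitfE -unitmxE.
  by apply: contraNneq => ->; rewrite horner0.
have [k dS] := dense_pigeonhole (fun t => inv (g t)) (dense_nonroot p12).
pose S t := (p1 * p2).[t] != 0 /\ inv (g t) = k.
have [t0 [St0 kt0]] : exists t, S t.
  apply: contrapT => nS; suff /eqP : (1 : {poly F}) = 0 by rewrite oner_eq0.
  by apply: dS => t St; case: nS; exists t.
have unit_g t : (p1 * p2).[t] != 0 -> g t \in unitmx.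
  by rewrite hornerM mulf_eq0 negb_or p1E -unitfE -unitmxE => /andP[].
pose M := line (delta r c (g t0) g0) (delta r c 0 v).
have ME t : evmx t M = delta r c (g t0) (g t).
  by rewrite ev_line -deltaD scaler0 addr0.
have rM t : S t -> (\rank (evmx t M) <= \rank (evmx t0 M))%N.
  case=> St kt; rewrite !ME eqv_rank_delta ?unit_g //.
  by apply: Hinv; rewrite ?unit_g // kt0 kt.
pose z : 'rV[F]_(n * n + n * n) := row_mx (mxvec 1%:M) (mxvec 1%:M).
have p1p : pat r r (1%:M : 'M[F]_n) := @pat_scalar _ _ _ _.
have p1p' : pat c c (1%:M : 'M[F]_n) := @pat_scalar _ _ _ _.
have z0 : z *m evmx t0 M = 0.
  by rewrite ME deltaE !pat_mask // mul1mx mulmx1 subrr linear0.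
have [Z [ZM Zt0]] := lift_ker dS rM z0.
(* The derivative of Z M = 0 at [t0] reads Z'(t0) delta(g(t0), g(t0)) - v = 0, hence [v] is tangent
   at [g t0]. *)
have := congr1 (evmx t0 \o map_mx deriv) ZM; rewrite /= deriv_mulmx deriv_line.
have -> : evmx t0 (map_mx deriv 0 : 'M_(1, n * n)) = 0.
  by apply/matrixP=> i j; rewrite !mxE linear0 /= /horner_eval horner0.
rewrite /evmx map_mxD -!/(evmx _ _) !evmxM evmxC Zt0 ME deltaE !pat_mask //.
rewrite mulmx0 mulmx1 sub0r linearN => /eqP; rewrite subr_eq0 => /eqP vE.
have vS : (mxvec v <= delta r c (g t0) (g t0))%MS by rewrite -vE submxMl.
have p2t0 : p2.[t0] != 0 by move: St0; rewrite hornerM mulf_eq0 negb_or => /andP[].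
have := Hp2 t0 p2t0; rewrite !ev_line scale0r addr0 scale_col_mx add_col_mx.
rewrite scaler0 addr0 -deltaD -/(g t0).
rewrite leqNgt => /negP; apply.
rewrite -!addsmxE; apply: (@leq_ltn_trans (\rank (delta r c g0 g0))).
  apply: leq_trans (max0 _ (unit_g _ St0)); apply: mxrankS.
  by rewrite addsmx_sub submx_refl.
rewrite ltn_neqAle mxrankS ?addsmxSl // andbT.
apply: contra Hv; rewrite (mxrank_leqif_sup (addsmxSl _ _)) addsmx_sub => /andP[] //.
Qed.

End Infinite.

(** * Direct sums and cancellation *)

Section Pairs.
Variable F : fieldType.

Definition mx2 m n := ('M[F]_(m, n) * 'M[F]_(m, n))%type.

Definition cmp m n k (f : mx2 m n) (g : mx2 n k) : mx2 m k := (f.1 *m g.1, f.2 *m g.2).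

Definition id2 n : mx2 n n := (1%:M, 1%:M).

Local Notation "f ** g" := (cmp f g) (at level 40, left associativity).

Lemma cmpA m n k l (f : mx2 m n) (g : mx2 n k) (h : mx2 k l) : f ** (g ** h) = f ** g ** h.
Proof. by rewrite /cmp !mulmxA. Qed.

Lemma cmp1l m n (f : mx2 m n) : id2 m ** f = f.
Proof. by case: f => x y; rewrite /cmp /= !mul1mx. Qed.

Lemma cmp1r m n (f : mx2 m n) : f ** id2 n = f.
Proof. by case: f => x y; rewrite /cmp /= !mulmx1. Qed.

Lemma cmp0l m n k (f : mx2 n k) : (0 : mx2 m n) ** f = 0.
Proof. by rewrite /cmp /= !mul0mx. Qed.

Lemma cmp0r m n k (f : mx2 m n) : f ** (0 : mx2 n k) = 0.
Proof. by rewrite /cmp /= !mulmx0. Qed.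

Lemma cmpDl m n k (f g : mx2 m n) (h : mx2 n k) : (f + g) ** h = f ** h + g ** h.
Proof. by rewrite /cmp /= !mulmxDl. Qed.

Lemma cmpDr m n k (h : mx2 m n) (f g : mx2 n k) : h ** (f + g) = h ** f + h ** g.
Proof. by rewrite /cmp /= !mulmxDr. Qed.

Lemma cmpBl m n k (f g : mx2 m n) (h : mx2 n k) : (f - g) ** h = f ** h - g ** h.
Proof. by rewrite /cmp /= !mulmxBl. Qed.

Lemma cmpBr m n k (h : mx2 m n) (f g : mx2 n k) : h ** (f - g) = h ** f - h ** g.
Proof. by rewrite /cmp /= !mulmxBr. Qed.

Lemma cmpZl m n k a (f : mx2 m n) (h : mx2 n k) : (a *: f) ** h = a *: (f ** h).
Proof. by rewrite /cmp /= -!scalemxAl. Qed.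

Lemma cmpZr m n k a (f : mx2 m n) (h : mx2 n k) : f ** (a *: h) = a *: (f ** h).
Proof. by rewrite /cmp /= -!scalemxAr. Qed.

End Pairs.

Notation "f ** g" := (cmp f g) (at level 40, left associativity).

Section Objects.
Variable F : fieldType.

Record obj n := Obj { rl : 'I_n -> label; cl : 'I_n -> label; mt : 'M[F]_n }.

(** Kept apart from [hom]: the projection onto a kernel respects the flags but need not commute with
    the matrices [mt]. *)
Definition pat2 m n (X : obj m) (Y : obj n) (f : mx2 F n m) : Prop :=
  pat (rl Y) (rl X) f.1 /\ pat (cl Y) (cl X) f.2.

Definition hom m n (X : obj m) (Y : obj n) (f : mx2 F n m) : Prop :=
  pat2 X Y f /\ f.1 *m mt X = mt Y *m f.2.

Lemma pat2M m n k (X : obj m) (Y : obj n) (Z : obj k) f g :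
  pat2 Y Z f -> pat2 X Y g -> pat2 X Z (f ** g).
Proof. by case=> p1 p2 [q1 q2]; split; [apply: patM p1 q1 | apply: patM p2 q2]. Qed.

Lemma pat2B m n (X : obj m) (Y : obj n) f g : pat2 X Y f -> pat2 X Y g -> pat2 X Y (f - g).
Proof. by case=> p1 p2 [q1 q2]; split; apply: patB. Qed.

Lemma hom_id n (X : obj n) : hom X X (id2 F n).
Proof. by split; [split; apply: pat_scalar | rewrite mul1mx mulmx1]. Qed.

Lemma homM m n k (X : obj m) (Y : obj n) (Z : obj k) f g :
  hom Y Z f -> hom X Y g -> hom X Z (f ** g).
Proof.
case=> p1 E1 [p2 E2]; split; first exact: pat2M p1 p2.
by rewrite /= -mulmxA E2 mulmxA E1 mulmxA.
Qed.

Lemma homB m n (X : obj m) (Y : obj n) f g : hom X Y f -> hom X Y g -> hom X Y (f - g).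
Proof.
case=> p1 E1 [p2 E2]; split; first exact: pat2B.
by rewrite /= mulmxBl mulmxBr E1 E2.
Qed.

Lemma homZ m n (X : obj m) (Y : obj n) a f : hom X Y f -> hom X Y (a *: f).
Proof.
by case=> [[p1 p2] E]; split; [split; apply: patZ | rewrite /= -scalemxAl -scalemxAr E].
Qed.

Lemma hom0 m n (X : obj m) (Y : obj n) : hom X Y 0.
Proof. by split; [split; apply: pat0 | rewrite /= mul0mx mulmx0]. Qed.

Lemma homD m n (X : obj m) (Y : obj n) f g : hom X Y f -> hom X Y g -> hom X Y (f + g).
Proof.
move=> hf hg; rewrite -[g]opprK -[- g]add0r; apply: homB hf _.
by apply: homB hg; apply: hom0.
Qed.

Lemma hom_inj m n (X : obj m) (Y : obj n) f g :
  mt Y \in unitmx -> hom X Y f -> hom X Y g -> f.1 = g.1 -> f = g.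
Proof.
move=> uY [_ E1] [_ E2] E; apply: injective_projections => //.
by rewrite -[f.2](mulKmx uY) -E1 E E2 mulKmx.
Qed.

Definition iso n (X Y : obj n) : Prop :=
  exists f g, [/\ hom X Y f, hom Y X g, g ** f = id2 F n & f ** g = id2 F n].

Lemma iso_eqv n (r c : 'I_n -> label) g h : iso (Obj r c g) (Obj r c h) -> eqv r c g h.
Proof.
case=> -[x y] [[x' y'] [[[/= px py] /= E] _ E1 E2]]; exists x, y; split=> //.
  by case: (mulmx1_unit (congr1 fst E1)).
by case: (mulmx1_unit (congr1 snd E1)).
Qed.

Lemma eqv_iso n (r c : 'I_n -> label) g h : eqv r c g h -> iso (Obj r c g) (Obj r c h).
Proof.
case=> x [y [[px py] ux uy E]]; exists (x, y), (invmx x, invmx y); split.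
- by [].
- split; first by split; apply: pat_inv.
  by rewrite /= -[g in RHS](mulKmx ux) E -!mulmxA mulmxV // mulmx1.
- by rewrite /cmp /= !mulVmx.
- by rewrite /cmp /= !mulmxV.
Qed.

Lemma iso_sym n (X Y : obj n) : iso X Y -> iso Y X.
Proof. by case=> f [g [? ? ? ?]]; exists g, f. Qed.

Lemma iso_trans n (Y X Z : obj n) : iso X Y -> iso Y Z -> iso X Z.
Proof.
case=> f [g [hf hg E1 E2]] [f' [g' [hf' hg' E1' E2']]].
exists (f' ** f), (g ** g'); split; first exact: homM hf' hf.
- exact: homM hg hg'.
- by rewrite cmpA -(cmpA g) E1' cmp1r.
- by rewrite cmpA -(cmpA f') E2 cmp1r.
Qed.

Definition retract m n (X : obj n) (Y : obj m) s t : Prop :=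
  [/\ hom Y X s, hom X Y t & t ** s = id2 F m].

Definition dsum m k n (X : obj n) (Y : obj m) (Z : obj k) : Prop :=
  exists s1 t1 s2 t2, [/\ retract X Y s1 t1, retract X Z s2 t2 &
                          s1 ** t1 + s2 ** t2 = id2 F n].

(** Inserting the decomposition of the identity between [t1] and [s2] produces [t1 ** s2] twice. *)
Lemma dsum_orth m k n (s1 : mx2 F n m) t1 (s2 : mx2 F n k) t2 :
  t1 ** s1 = id2 F m -> t2 ** s2 = id2 F k -> s1 ** t1 + s2 ** t2 = id2 F n ->
  t1 ** s2 = 0 /\ t2 ** s1 = 0.
Proof.
move=> E1 E2 E; split.
  have := congr1 (fun f => t1 ** f ** s2) E; rewrite cmpDr cmpDl cmp1r !cmpA E1 cmp1l.
  by rewrite -[_ ** t2 ** s2]cmpA E2 cmp1r => /eqP; rewrite -subr_eq0 addrK => /eqP.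
have := congr1 (fun f => t2 ** f ** s1) E; rewrite cmpDr cmpDl cmp1r !cmpA E2 cmp1l.
by rewrite -[_ ** t1 ** s1]cmpA E1 cmp1r addrC => /eqP; rewrite -subr_eq0 addrK => /eqP.
Qed.

Lemma iso_dsum m k n (X X' : obj n) (Y Y' : obj m) (Z Z' : obj k) :
  dsum X Y Z -> dsum X' Y' Z' -> iso Y Y' -> iso Z Z' -> iso X X'.
Proof.
case=> s1 [t1 [s2 [t2 [[hs1 ht1 E1] [hs2 ht2 E2] E]]]].
case=> s1' [t1' [s2' [t2' [[hs1' ht1' E1'] [hs2' ht2' E2'] E']]]].
case=> f1 [g1 [hf1 hg1 gf1 fg1]] [f2 [g2 [hf2 hg2 gf2 fg2]]].
have [o12 o21] := dsum_orth E1 E2 E; have [o12' o21'] := dsum_orth E1' E2' E'.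
have key (a1 : mx2 F n m) a2 (b1 : mx2 F m n) (b2 : mx2 F k n) (c1 : mx2 F n m) (c2 : mx2 F n k)
    (d1 : mx2 F m n) d2 (u1 : mx2 F m m) u2 (v1 : mx2 F m m) (v2 : mx2 F k k) :
    b1 ** c1 = id2 F m -> b2 ** c2 = id2 F k -> b1 ** c2 = 0 -> b2 ** c1 = 0 ->
    v1 ** u1 = id2 F m -> v2 ** u2 = id2 F k -> a1 ** d1 + a2 ** d2 = id2 F n ->
    (a1 ** v1 ** b1 + a2 ** v2 ** b2) ** (c1 ** u1 ** d1 + c2 ** u2 ** d2) = id2 F n.
  move=> b1c1 b2c2 b1c2 b2c1 vu1 vu2 ad; rewrite -ad cmpDl !cmpDr !cmpA.
  rewrite -(cmpA _ b1 c1) -(cmpA _ b1 c2) -(cmpA _ b2 c1) -(cmpA _ b2 c2).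
  rewrite b1c1 b2c2 b1c2 b2c1 !cmp1r !cmp0r !cmp0l addr0 add0r.
  by rewrite -(cmpA _ v1 u1) -(cmpA _ v2 u2) vu1 vu2 !cmp1r.
exists (s1' ** f1 ** t1 + s2' ** f2 ** t2), (s1 ** g1 ** t1' + s2 ** g2 ** t2'); split.
- by apply: homD; [apply: homM ht1 | apply: homM ht2]; apply: homM; eassumption.
- by apply: homD; [apply: homM ht1' | apply: homM ht2']; apply: homM; eassumption.
- exact: key.
- exact: key.
Qed.

Lemma left_inv_iso n (X Y : obj n) f g : mt X \in unitmx ->
  hom X Y f -> hom Y X g -> g ** f = id2 F n -> iso X Y.
Proof.
move=> uX hf hg gf; exists f, g; split=> //; apply: injective_projections => /=.
  exact: mulmx1C (congr1 fst gf).
exact: mulmx1C (congr1 snd gf).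
Qed.

(* Schur complement of the 1 x 1 block d of an isomorphism of direct sums; when d = 0 it
   is first composed with a transvection making that block equal to 1. *)
Lemma thin_cancel n (X X' : obj n.+1) (Y Y' : obj n) (E : obj 1) :
  mt Y \in unitmx -> mt E = 1%:M -> dsum X Y E -> dsum X' Y' E -> iso X X' -> iso Y Y'.
Proof.
move=> uY uE [s1 [t1 [s2 [t2 [[hs1 ht1 E1] [hs2 ht2 E2] EE]]]]].
case=> s1' [t1' [s2' [t2' [[hs1' ht1' E1'] [hs2' ht2' E2'] EE']]]].
have [o12 o21] := dsum_orth E1 E2 EE; have [o12' o21'] := dsum_orth E1' E2' EE'.
have main f g a : hom X X' f -> hom X' X g -> g ** f = id2 F n.+1 -> a != 0 ->
    t2' ** f ** s2 = a *: id2 F 1 -> iso Y Y'.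
  move=> hf hg gf a0 da.
  have h1 := homM ht1' hf; have h2 := homM ht2' hf.
  (* The Schur complement; its left inverse is the block of [g] from [Y'] to [Y]. *)
  have hS := homB (homM h1 hs1) (homZ a^-1 (homM (homM h1 hs2) (homM h2 hs1))).
  apply: (left_inv_iso uY hS (homM (homM ht1 hg) hs1')).
  have st1 : s1' ** t1' = id2 F _ - s2' ** t2' by rewrite -EE' addrK.
  have E3 k (h : mx2 F n.+1 k) : t1 ** g ** s1' ** (t1' ** f ** h) =
      t1 ** h - t1 ** g ** s2' ** (t2' ** f ** h).
    rewrite !cmpA -(cmpA _ s1') st1 cmpBr cmp1r !cmpBl -!(cmpA _ g) !cmpA.
    by rewrite -(cmpA _ g f) gf cmp1r.
  rewrite cmpBr cmpZr E3 E1 (cmpA (t1 ** g ** s1')) E3 o12 sub0r da cmpZr cmp1r.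
  by rewrite -[- (a *: _)]scaleNr cmpZl scalerA mulrN mulVf // scaleN1r opprK subrK.
case=> f [g [hf hg gf fg]].
pose d := t2' ** f ** s2.
have [_ d12] : hom E E d by apply: homM hs2; apply: homM ht2' hf.
have dE : d = d.1 0 0 *: id2 F 1.
  rewrite uE mulmx1 mul1mx in d12.
  apply: injective_projections; last rewrite -d12; apply/matrixP=> i j;
    by rewrite !ord1 !mxE eqxx mulr1.
case: (eqVneq (d.1 0 0) 0) => [d0|nd]; last exact: main hf hg gf nd dE.
have {dE d0} d0 : t2' ** f ** s2 = 0 by rewrite -/d dE d0 scale0r.
(* Composing [f] with [1 + w] turns the zero block into [t2' ** f ** (s1 ** t1) ** g ** s2']. As
   [t2' ** f ** s2 = 0], the factor [s1 ** t1] acts there as the identity, and what remains is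
   [t2' ** s2'], which is 1. *)
pose w := s1 ** (t1 ** g ** s2') ** t2.
have hw : hom X X w by apply: homM ht2; apply: homM hs1 _; apply: homM hs2'; apply: homM ht1 hg.
have ww : w ** w = 0 by rewrite /w !cmpA -(cmpA _ t2 s1) o21 cmp0r !cmp0l.
apply: (main (f ** (id2 F _ + w)) ((id2 F _ - w) ** g) 1); rewrite ?oner_eq0 ?scale1r //.
- exact: homM hf (homD (hom_id X) hw).
- exact: homM (homB (hom_id X) hw) hg.
- by rewrite !cmpA -(cmpA _ g f) gf cmp1r cmpBl !cmpDr !cmp1l cmp1r ww addr0 addrK.
rewrite cmpDr !cmpA cmp1r cmpDr cmpDl d0 add0r /w !cmpA -(cmpA _ t2 s2) E2 cmp1r.
have -> : t2' ** f ** s1 ** t1 = t2' ** f.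
  have -> : t2' ** f ** s1 ** t1 = t2' ** f ** (id2 F _ - s2 ** t2) by rewrite -EE addrK cmpA.
  by rewrite cmpBr cmp1r cmpA d0 cmp0l subr0.
by rewrite -(cmpA _ f g) fg cmp1r.
Qed.
End Objects.

(** * Indecomposable objects are rigid bricks *)

Section KernelObjects.
Variable F : fieldType.

Definition sublabel m n (Y : obj F m) (X : obj F n) : Prop :=
  exists (i k : 'I_m -> 'I_n), [/\ injective i, injective k,
    rl Y = rl X \o i & cl Y = cl X \o k].

(** Since [f.1 *m mt X = mt X *m f.2] with [mt X] invertible, [mt X] carries the kernel of [f.2]
    onto that of [f.1]. Hence the two adapted bases have equal length, and the kernel is an object
    with invertible matrix. *)
Lemma kernel_object n (X : obj F n) f : mt X \in unitmx -> hom X X f ->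
  exists m (Y : obj F m) s t,
  [/\ sublabel Y X /\ mt Y \in unitmx, hom Y X s, pat2 X Y t, t ** s = id2 F m &
   [/\ f ** s = 0, forall k (z : 'M_(n, k)), f.2 *m z = 0 -> z = s.2 *m (t.2 *m z) &
   forall k (W : obj F k) u, hom W X u -> f ** u = 0 -> s ** (t ** u) = u /\ hom W Y (t ** u)]].
Proof.
move=> uX [[p1 p2] E].
have [m1 [i [s1 [t1 [ii ps1 pt1 ts1 [xs1 K1]]]]]] := kernel_split p1.
have [m2 [k [s2 [t2 [ik ps2 pt2 ts2 [xs2 K2]]]]]] := kernel_split p2.
pose h := t1 *m mt X *m s2; pose h' := t2 *m invmx (mt X) *m s1.
have sh : s1 *m h = mt X *m s2.
  rewrite /h -[t1 *m _ *m _]mulmxA -K1 //.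
  by rewrite mulmxA E -mulmxA xs2 mulmx0.
have sh' : s2 *m h' = invmx (mt X) *m s1.
  rewrite /h' -[t2 *m _ *m _]mulmxA -K2 //.
  have -> : f.2 = invmx (mt X) *m (f.1 *m mt X) by rewrite E mulKmx.
  by rewrite -!mulmxA mulKVmx // xs1 mulmx0.
have hh' : h *m h' = 1%:M.
  by rewrite -(mul1mx (h *m h')) -ts1 -mulmxA (mulmxA s1) sh -mulmxA sh' mulKVmx.
have h'h : h' *m h = 1%:M.
  by rewrite -(mul1mx (h' *m h)) -ts2 -mulmxA (mulmxA s2) sh' -mulmxA sh mulKmx.
have m12 : m1 = m2 by apply/eqP; rewrite eqn_leq (mulmx1_min hh') (mulmx1_min h'h).
case: m2 / m12 k s2 t2 ik ps2 pt2 ts2 xs2 K2 @h @h' sh sh' hh' h'h => k s2 t2 ik ps2 pt2 ts2 xs2 K2 h h' sh sh' hh' h'h.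
exists m1, (Obj (rl X \o i) (cl X \o k) h), (s1, s2), (t1, t2); split.
- by split; [exists i, k | case: (mulmx1_unit hh')].
- by split.
- by split.
- by rewrite /cmp /= ts1 ts2.
split; [by rewrite /cmp /= xs1 xs2 | exact: K2 |].
move=> l W u [[q1 q2] Eu] [/K1 e1 /K2 e2].
split; first by apply: injective_projections => /=; rewrite -?e1 -?e2.
split; first by split; [apply: patM q1 | apply: patM q2].
rewrite /= -!mulmxA Eu {1}e2 (mulmxA (mt X)) -sh !mulmxA ts1 mul1mx //.
Qed.

(** The image of [e] is the kernel of [1 - e]. *)
Lemma split_idempotent n (X : obj F n) e : mt X \in unitmx -> hom X X e -> e ** e = e ->
  exists m (Y : obj F m) s t,
  [/\ sublabel Y X, mt Y \in unitmx, retract X Y s t & s ** t = e].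
Proof.
move=> uX he ee.
have hf : hom X X (id2 F n - e) by apply: homB he; apply: hom_id.
have [m [Y [s [t [[sl uY] hs pt ts [fs _ K]]]]]] := kernel_object uX hf.
have fe : (id2 F n - e) ** e = 0 by rewrite cmpBl cmp1l ee subrr.
have es : e ** s = s by move/eqP: fs; rewrite cmpBl cmp1l subr_eq0 => /eqP.
have [ste ht] := K _ _ _ he fe.
by exists m, Y, s, (t ** e); split=> //; split=> //; rewrite -cmpA es ts.
Qed.

Definition indec n (X : obj F n) : Prop :=
  forall e, hom X X e -> e ** e = e -> e = 0 \/ e = id2 F n.

Definition brick n (X : obj F n) : Prop :=
  forall f, hom X X f -> exists a, f = a *: id2 F n.

(** Surjectivity of [delta], that is, Ext^1(X, X) = 0: every direction is tangent to the class of
    X. *)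
Definition rigid n (X : obj F n) : Prop :=
  forall w : 'M_n, exists2 f, pat2 X X f & w = f.1 *m mt X - mt X *m f.2.

(** Positivity of the Tits form on nonzero sub-vectors. A sub-vector is a choice of row and column
    indices, equally many because the block sizes of rows and of columns have the same sum. *)
Definition qpos n (r c : 'I_n -> label) : Prop :=
  forall m (i k : 'I_m -> 'I_n), injective i -> injective k -> (0 < m)%N ->
  (m * m < npat (r \o i) + npat (c \o k))%N.

Lemma qpos_sublabel m n (Y : obj F m) (X : obj F n) :
  sublabel Y X -> qpos (rl X) (cl X) -> qpos (rl Y) (cl Y).
Proof.
case=> i [k [ii ik -> ->]] q l i' k' ii' ik' l0.
exact: q (inj_comp ii ii') (inj_comp ik ik') l0.
Qed.

(** dim End <= 1 and dim End - dim Ext^1 >= 1 leave no Ext^1. *)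
Lemma brick_rigid n (X : obj F n) : (0 < n)%N -> qpos (rl X) (cl X) -> brick X -> rigid X.
Proof.
move=> n0 q bX w.
have full : row_full (delta (rl X) (cl X) (mt X) (mt X)).
  rewrite /row_full eqn_leq rank_leq_col /= -ltnS.
  have := q n id id (@inj_id _) (@inj_id _) n0.
  rewrite -(rank_delta _ _ (mt X) (mt X)) => /leq_trans; apply.
  rewrite -addn1 leq_add2l.
  apply: leq_trans (rank_leq_row (row_mx (mxvec 1%:M) (mxvec 1%:M) : 'rV[F]_(n * n + n * n))).
  apply: mxrankS; apply/rV_subP=> z /ker_deltaP[x [y [px py E ->]]].
  have [a [-> ->]] : exists a, (x, y) = a *: id2 F n by apply: bX.
  by rewrite !linearZ /= -scale_row_mx scalemx_sub.
have /deltaP[x [y [px py E]]] := submx_full (mxvec w) full.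
exists (x, y) => //; exact: (can_inj mxvecK).
Qed.

Lemma rigid_full n (X : obj F n) : rigid X -> row_full (delta (rl X) (cl X) (mt X) (mt X)).
Proof.
move=> rX; rewrite -sub1mx; apply/row_subP=> i.
have [f [p1 p2] E] := rX (vec_mx (row i 1%:M)).
by apply/deltaP; exists f.1, f.2; split=> //; rewrite -E vec_mxK.
Qed.

End KernelObjects.

Section Bricks.
Variable F : closedFieldType.

Lemma hom_horner n (X : obj F n.+1) f p :
  hom X X f -> hom X X (horner_mx f.1 p, horner_mx f.2 p).
Proof.
case=> [[p1 p2] E]; split; first by split; apply: pat_horner.
have EX i : f.1 ^+ i *m mt X = mt X *m f.2 ^+ i.
  elim: i => [|i IH]; first by rewrite !expr0 mul1mx mulmx1.
  rewrite exprSr (exprSr f.2); change (f.1 ^+ i *m f.1 *m mt X = mt X *m (f.2 ^+ i *m f.2)).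
  by rewrite -mulmxA E mulmxA IH -mulmxA.
rewrite /= -[p]coefK poly_def !rmorph_sum /= mulmx_suml mulmx_sumr.
apply: eq_bigr => i _.
by rewrite !linearZ !rmorphXn /= !horner_mx_X -scalemxAl EX scalemxAr.
Qed.

(** Fitting's lemma: the projector onto the generalized eigenspace of [a] is a polynomial in [f],
    hence an idempotent endomorphism. It fixes an eigenvector, so it is not 0 and must be 1. *)
Lemma indec_nilpotent n (X : obj F n.+1) f : mt X \in unitmx -> indec X -> hom X X f ->
  exists a k, (f.1 - a%:M) ^+ k = 0.
Proof.
move=> uX iX hf; pose A := f.1; pose chi := char_poly A.
have chi0 : chi != 0 by rewrite monic_neq0 ?char_poly_monic.
have [a ra] : exists a, root chi a by apply/closed_rootP; rewrite size_char_poly.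
have [k [Q nQa chiE]] := multiplicity_XsubC chi a; rewrite chi0 /= in nQa.
have cop : coprimep (('X - a%:P) ^+ k) Q by apply: coprimep_expl; rewrite coprimep_sym coprimep_XsubC.
have /Bezout_eq1_coprimepP[[U W] /= UW] := cop.
have he := hom_horner (W * Q) hf.
have CH : horner_mx A chi = 0 by exact: Cayley_Hamilton.
exists a, k; have -> : (A - a%:M) ^+ k = horner_mx A (('X - a%:P) ^+ k).
  by rewrite rmorphXn rmorphB /= horner_mx_X horner_mx_C.
have idem : horner_mx A (W * Q) *m horner_mx A (W * Q) = horner_mx A (W * Q).
  rewrite -[_ *m _]rmorphM /=.
  have -> : W * Q * (W * Q) = W * Q - W * U * chi.
    have e1 : W * Q = 1 - U * ('X - a%:P) ^+ k by rewrite -UW addrAC subrr add0r.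
    by rewrite {2}e1 mulrBr mulr1 chiE mulrACA.
  by rewrite rmorphB [in X in _ - X]rmorphM /= CH mulr0 subr0.
case: (iX _ he) => [|e0|e1].
- apply: (hom_inj uX (homM he he) he) => //.
- have /eigenvalueP[v vA v0] : eigenvalue A a by rewrite eigenvalue_root_char.
  have := congr1 (horner_mx A) UW; rewrite rmorphD rmorph1 /=.
  have -> : horner_mx A (W * Q) = 0 by have := congr1 fst e0.
  rewrite addr0 => /(congr1 (mulmx v)); rewrite mulmx1 => E.
  have k0 : (0 < k)%N by rewrite lt0n; apply: contraTneq ra => k0; rewrite chiE k0 expr0 mulr1.
  have vL : v *m horner_mx A ('X - a%:P) = 0.
    by rewrite rmorphB /= horner_mx_X horner_mx_C mulmxBr vA mul_mx_scalar subrr.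
  case/eqP: v0; rewrite -E -(prednK k0) exprS mulrCA rmorphM /=.
  by rewrite -[RHS](mul0mx _ (horner_mx A (U * ('X - a%:P) ^+ k.-1))) -vL -mulmxA.
- have WQ1 : horner_mx A (W * Q) = 1 by have := congr1 fst e1.
  rewrite -[LHS]mulr1 -WQ1 -rmorphM /=.
  have -> : ('X - a%:P) ^+ k * (W * Q) = W * chi by rewrite chiE mulrCA [_ * Q]mulrC.
  by rewrite rmorphM /= CH mulr0.
Qed.

(** A non-scalar endomorphism minus its eigenvalue is a nonzero nilpotent N; its last nonzero power
    N^(k-1) squares to 0 because k >= 2 gives 2(k - 1) >= k. *)
Lemma indec_square_zero n (X : obj F n) : mt X \in unitmx -> indec X -> ~ brick X ->
  exists f, [/\ hom X X f, f <> 0 & f ** f = 0].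
Proof.
case: n X => [|n] X uX iX nb.
  case: nb => f _; exists 0; by apply: injective_projections; apply/matrixP=> -[].
have [f hf nf] : exists2 f, hom X X f & forall a, f <> a *: id2 F n.+1.
  apply: contrapT => nex; apply: nb => f hf; apply: contrapT => na; apply: nex.
  by exists f => // a fa; apply: na; exists a.
have [a [k0 Nk0]] := indec_nilpotent uX iX hf.
pose N := f - a *: id2 F n.+1.
have hN : hom X X N by apply: homB hf (homZ _ (hom_id X)).
have N1 : N.1 = f.1 - a%:M by rewrite /N /= scalemx1.
have exk : exists k, N.1 ^+ k == 0 by exists k0; rewrite N1; apply/eqP.
case: (ex_minnP exk) => k /eqP Nk mink.
have hP j : hom X X (horner_mx N.1 'X^j, horner_mx N.2 'X^j) := hom_horner _ hN.
have PE j : horner_mx N.1 'X^j = N.1 ^+ j by rewrite rmorphXn /= horner_mx_X.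
have k2 : (1 < k)%N.
  rewrite ltnNge; apply/negP=> k1; apply: (nf a); apply/eqP; rewrite -subr_eq0 -/N; apply/eqP.
  apply: (hom_inj uX hN (hom0 _ _)); case: k k1 Nk {mink} => [|[|//]] _; last by rewrite expr1.
  by rewrite expr0 => /eqP; rewrite oner_eq0.
exists (horner_mx N.1 'X^(k.-1), horner_mx N.2 'X^(k.-1)); split=> //.
  move/(congr1 fst)/eqP => /=; rewrite PE => /mink.
  by rewrite leqNgt prednK ?leqnn // ltnW.
apply: (hom_inj uX (homM (hP _) (hP _)) (hom0 _ _)).
rewrite /= !PE -[_ *m _]exprD -(subnK (_ : k <= k.-1 + k.-1)%N).
  by rewrite exprD Nk mulr0.
by case: k k2 {mink Nk} => [|[|k]] //= _; rewrite addSn addnS !ltnS leq_addr.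
Qed.
End Bricks.

Section Retracts.
Variable F : fieldType.

Lemma ker_sub_factor m n k (f : 'M[F]_(m, n)) (g : 'M_(k, n)) :
  (forall l (z : 'M_(n, l)), f *m z = 0 -> g *m z = 0) -> exists w, g = w *m f.
Proof.
move=> K; apply/submxP; rewrite submxE; apply/eqP/K; exact: mulmx_coker.
Qed.

Lemma retract_le m n (s : mx2 F n m) (t : mx2 F m n) : t ** s = id2 F m -> (m <= n)%N.
Proof. by move/(congr1 fst); apply: mulmx1_min. Qed.

Lemma retract_eq m n (s : mx2 F n m) (t : mx2 F m n) :
  m = n -> t ** s = id2 F m -> s ** t = id2 F n.
Proof.
by move=> mn; case: n / mn s t => s t ts; apply: injective_projections => /=;
  [apply: mulmx1C (congr1 fst ts) | apply: mulmx1C (congr1 snd ts)].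
Qed.

Lemma hom_rank n m (X : obj F n) (Y : obj F m) f : mt X \in unitmx -> mt Y \in unitmx ->
  hom X Y f -> \rank f.1 = \rank f.2.
Proof.
by move=> uX uY [_ /(congr1 mxrank)]; rewrite mxrankMfree ?row_free_unit // eqmxMfull ?row_full_unit.
Qed.

Lemma idempotent_full n (X : obj F n) e : mt X \in unitmx -> hom X X e -> e ** e = e ->
  (n <= \rank e.1)%N -> e = id2 F n.
Proof.
move=> uX he ee rk; apply: (hom_inj uX he (hom_id X)) => /=.
have ue : e.1 \in unitmx by rewrite -row_free_unit /row_free eqn_leq rank_leq_row.
by rewrite -[LHS](mulKmx ue) -[e.1 *m e.1]/((e ** e).1) ee mulVmx.
Qed.

End Retracts.

Section Ringel.
Variable F : closedFieldType.

(* Over a non-brick indecomposable X take a square-zero endomorphism f of minimal rank and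
   an indecomposable summand Z of its kernel Y which f meets: f may then be assumed to map X
   to Z and to have kernel Y.  By induction Z is a brick, hence rigid, and rigidity lets the
   projection Y -> Z be extended to X, making Z a summand of X. *)
Lemma brick_of_indec n (X : obj F n) :
  mt X \in unitmx -> qpos (rl X) (cl X) -> indec X -> brick X.
Proof.
have [l] := ubnP n; elim: l n X => // l IH n X; rewrite ltnS => nl uX q iX.
apply: contrapT => nb.
pose P j := `[< exists f, [/\ hom X X f, f <> 0, f ** f = 0 & \rank f.1 = j] >].
have exP : exists j, P j.
  have [f [hf f0 ff]] := indec_square_zero uX iX nb.
  by exists (\rank f.1); apply/asboolP; exists f.
case: (ex_minnP exP) => j /asboolP[f [hf f0 ff rf]] minj.
have {rf}minf f' : hom X X f' -> f' <> 0 -> f' ** f' = 0 -> (\rank f.1 <= \rank f'.1)%N.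
  by move=> hf' f'0 ff'; rewrite rf; apply: minj; apply/asboolP; exists f'.
have [m [Y [s [t [[sY uY] hs pt ts [fs K2 K]]]]]] := kernel_object uX hf.
have [sf hf1] := K _ _ _ hf ff; set f1 := t ** f in sf hf1.
have f1s : f1 ** s = 0 by rewrite /f1 -cmpA fs cmp0r.
(* Among the idempotents of [Y] not killing [f1], one of minimal rank has an indecomposable
   image. *)
pose Q j := `[< exists e, [/\ hom Y Y e, e ** e = e, e ** f1 <> 0 & \rank e.1 = j] >].
have exQ : exists j, Q j.
  exists (\rank (id2 F m).1); apply/asboolP; exists (id2 F m); split=> //.
  - exact: hom_id.
  - by rewrite cmp1l.
  - by rewrite cmp1l => E; apply: f0; rewrite -sf E cmp0r.
case: (ex_minnP exQ) => i /asboolP[e [he ee ef1 re]] mini.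
have {re}mine e' : hom Y Y e' -> e' ** e' = e' -> e' ** f1 <> 0 -> (\rank e.1 <= \rank e'.1)%N.
  by move=> he' ee' ef'; rewrite re; apply: mini; apply/asboolP; exists e'.
have [k [Z [s' [t' [sZ uZ [hs' ht' ts'] st']]]]] := split_idempotent uY he ee.
pose phi := t' ** f1.
have hphi : hom X Z phi by apply: homM ht' hf1.
have sphi : s' ** phi = e ** f1 by rewrite cmpA st'.
have phi0 : phi <> 0 by move=> E; apply: ef1; rewrite -sphi E cmp0r.
have k0 : (0 < k)%N.
  rewrite lt0n; apply: contra_notN phi0 => /eqP k0.
  by apply: injective_projections; apply/matrixP=> -[x xk]; exfalso; rewrite k0 in xk.
have rke : (k <= \rank e.1)%N.
  rewrite -st'; apply: (@rank_unit_le _ _ _ _ _ t'.1 s'.1).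
  have E : t' ** (s' ** t') ** s' = id2 F k by rewrite !cmpA ts' cmp1l ts'.
  by rewrite -[_ *m _]/((t' ** (s' ** t') ** s').1) E unitmx1.
have iZ : indec Z.
  move=> d hd dd.
  (* One of [d] and [1 - d] does not kill [phi]; minimality of the rank of [e] then makes it the
     identity. *)
  have step d' : hom Z Z d' -> d' ** d' = d' -> s' ** d' ** t' ** f1 <> 0 -> d' = id2 F k.
    move=> hd' dd' nz; apply: (idempotent_full uZ hd' dd').
    apply: leq_trans rke (leq_trans (mine (s' ** d' ** t') _ _ nz) _).
    - by apply: homM ht'; apply: homM hs' hd'.
    - by rewrite !cmpA -(cmpA _ t' s') ts' cmp1r -(cmpA s' d' d') dd'.
    - by apply: leq_trans (mxrankM_maxl _ _) (mxrankM_maxr _ _).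
  case: (pselect (s' ** d ** t' ** f1 = 0)) => [z|nz]; last by right; apply: step.
  left; suff E : id2 F k - d = id2 F k.
    by apply: (addrI (id2 F k - d)); rewrite subrK addr0 E.
  apply: step.
  - by apply: homB hd; apply: hom_id.
  - by rewrite cmpBl cmp1l cmpBr cmp1r dd subrr subr0.
  - by rewrite cmpBr cmp1r !cmpBl z subr0 st'.
have km := retract_le ts'; have mn := retract_le ts.
have mln : (m < n)%N.
  rewrite ltn_neqAle mn andbT; apply/eqP => /retract_eq/(_ ts) st; apply: f0.
  by rewrite -[f]cmp1r -st cmpA fs cmp0l.
have qZ : qpos (rl Z) (cl Z).
  exact: qpos_sublabel sZ (qpos_sublabel sY q).
have rZ : rigid Z.
  apply: (brick_rigid k0 qZ); apply: IH => //.
  exact: leq_trans (leq_ltn_trans km mln) nl.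
(* [f'] is again nonzero with square 0, so minimality of [f] bounds the rank of [phi] below. As
   [phi] factors through [f], both have the same kernel, and [f.2] factors back through [phi.2]. *)
pose f' := s ** s' ** phi.
have hf' : hom X X f' by apply: homM hphi; apply: homM hs hs'.
have tsf' : t' ** (t ** f') = phi by rewrite /f' -(cmpA s) (cmpA t) ts cmp1l (cmpA t') ts' cmp1l.
have phis : phi ** s = 0 by rewrite /phi -cmpA f1s cmp0r.
have ff' : f' ** f' = 0 by rewrite /f' -(cmpA s) -(cmpA s) -(cmpA s') (cmpA phi) phis cmp0l !cmp0r.
have f'0 : f' <> 0 by move=> E; apply: phi0; rewrite -tsf' E !cmp0r.
have rk1 : (\rank f.1 <= \rank phi.1)%N.
  exact: leq_trans (minf f' hf' f'0 ff') (mxrankM_maxr _ _).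
have [w0 Hw0] : exists w, f.2 = w *m phi.2.
  apply/submxP; have le : (phi.2 <= f.2)%MS.
    by apply/submxP; exists (t'.2 *m t.2); rewrite -mulmxA.
  by rewrite -(mxrank_leqif_sup le) eqn_leq mxrankS //= -(hom_rank uX uZ hphi) -(hom_rank uX uX hf).
(* [rho] extends [t'] from [Y] to [X] as a flag-preserving map. Its defect [D] vanishes on [Y], so
   it factors through [f.2] and then through [phi.2]. Rigidity of [Z] writes the cofactor as
   [a *m mt Z - mt Z *m b], and subtracting [(a, b) ** phi], which is 0 on [Y], turns [rho] into a
   morphism. *)
pose rho := t' ** t.
have prho : pat2 X Z rho by case: ht' => p _; apply: pat2M p pt.
pose D := rho.1 *m mt X - mt Z *m rho.2.
have rhos : rho ** s = t' by rewrite /rho -cmpA ts cmp1r.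
have Ds : D *m s.2 = 0.
  have [_ Es] := hs; have [_ Et'] := ht'.
  rewrite mulmxBl -(mulmxA rho.1) -(mulmxA (mt Z)) -Es (mulmxA rho.1 s.1) [rho.1 *m s.1](congr1 fst rhos).
  by rewrite [rho.2 *m s.2](congr1 snd rhos) Et' subrr.
have [w1 Hw1] : exists w, D = w *m f.2.
  by apply: ker_sub_factor => a z /K2 ->; rewrite (mulmxA D) Ds mul0mx.
have [[a b] [pa pb] Hab] := rZ (w1 *m w0).
pose psi := rho - (a, b) ** phi.
have hpsi : hom X Z psi.
  have [pphi Ephi] := hphi.
  split; first by apply: pat2B prho _; apply: pat2M pphi.
  have e1 : a *m phi.1 *m mt X = a *m mt Z *m phi.2 by rewrite -mulmxA Ephi mulmxA.
  have e2 : rho.1 *m mt X = mt Z *m rho.2 + (a *m mt Z *m phi.2 - mt Z *m (b *m phi.2)).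
    rewrite (mulmxA (mt Z) b) -mulmxBl -[a *m mt Z - _]Hab -(mulmxA w1) -Hw0 -Hw1.
    by rewrite addrC subrK.
  by rewrite mulmxBl mulmxBr e1 e2 -addrA [_ - _ - _]addrAC subrr sub0r.
have psis : psi ** (s ** s') = id2 F k.
  by rewrite /psi cmpBl (cmpA rho) rhos ts' -(cmpA _ phi) (cmpA phi) phis cmp0l cmp0r subr0.
have hss : hom Z X (s ** s') by apply: homM hs hs'.
case: (iX (s ** s' ** psi)).
- exact: homM hss hpsi.
- by rewrite cmpA -(cmpA _ psi) psis cmp1r.
- move=> E; apply: phi0.
  by rewrite -[phi]cmp1l -psis -[psi]cmp1l -psis -!cmpA (cmpA s) (cmpA _ psi) E cmp0l !cmp0r.
- move=> /retract_le; rewrite leqNgt => /negP; apply; exact: leq_ltn_trans km mln.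
Qed.
End Ringel.

Section Rigid.
Variables (F : closedFieldType) (n : nat) (r c : 'I_n -> label).
Implicit Types g h : 'M[F]_n.

(** At a rigid object [delta] has full rank, so [lift_ker] extends the identity to polynomial x(t),
    y(t) with x(t) g = (g + t (h - g)) y(t); [p] is the product of their determinants. *)
Lemma rigid_generic g h : rigid (Obj r c g) ->
  exists p : {poly F}, p.[0] != 0 /\ forall t, p.[t] != 0 -> eqv r c g (g + t *: (h - g)).
Proof.
move=> rg; pose M := line (delta r c g g) (delta r c 0 (h - g)).
have ME t : evmx t M = delta r c g (g + t *: (h - g)).
  by rewrite ev_line -deltaD scaler0 addr0.
have full := rigid_full rg.
have rM (t : F) : (1 : {poly F}).[t] != 0 -> (\rank (evmx t M) <= \rank (evmx 0 M))%N.
  by move=> _; rewrite [in leqRHS]ME scale0r addr0 (eqP full) rank_leq_col.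
have p1 (s : 'I_n -> label) : pat s s (1%:M : 'M[F]_n) := @pat_scalar _ _ _ _.
pose z : 'rV[F]_(n * n + n * n) := row_mx (mxvec 1%:M) (mxvec 1%:M).
have z0 : z *m evmx 0 M = 0.
  by rewrite ME deltaE !pat_mask // mul1mx mulmx1 scale0r addr0 subrr linear0.
have [Z [ZM Z0]] := lift_ker (dense_nonroot (oner_neq0 _)) rM z0.
pose x := \matrix_(i, j) (Z 0 (lshift _ (mxvec_index i j)) *+ lle (r i) (r j)).
pose y := \matrix_(i, j) (Z 0 (rshift _ (mxvec_index i j)) *+ lle (c i) (c j)).
have xE t : evmx t x = pmask r r (vec_mx (lsubmx (evmx t Z))).
  by apply/matrixP=> i j; rewrite !mxE raddfMn.
have yE t : evmx t y = pmask c c (vec_mx (rsubmx (evmx t Z))).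
  by apply/matrixP=> i j; rewrite !mxE raddfMn.
exists (\det x * \det y); split.
  rewrite hornerM -!evmx_det xE yE Z0 row_mxKl row_mxKr !mxvecK !pat_mask //.
  by rewrite det1 mulr1 oner_eq0.
move=> t; rewrite hornerM mulf_eq0 negb_or -!evmx_det -!unitfE -!unitmxE => /andP[ux uy].
exists (evmx t x), (evmx t y); split=> //; first by rewrite xE yE; split; apply: mask_pat.
apply/eqP; rewrite -subr_eq0; apply/eqP; apply: (can_inj mxvecK).
rewrite xE yE -deltaE !vec_mxK hsubmxK -ME -evmxM ZM linear0.
by apply/matrixP=> i j; rewrite !mxE linear0.
Qed.

Lemma rigid_eqv g h : rigid (Obj r c g) -> rigid (Obj r c h) -> iso (Obj r c g) (Obj r c h).
Proof.
move=> /(rigid_generic h)[p [p0 Hp]] /(rigid_generic g)[q [q0 Hq]].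
have nz (s : {poly F}) a : s.[a] != 0 -> s != 0.
  by apply: contraNneq => ->; rewrite horner0.
have [t] : exists t, (p * (q \Po (1 - 'X))).[t] != 0.
  apply: poly_nonroot; apply: mulf_neq0; first exact: nz p0.
  by apply: (nz _ 1); rewrite horner_comp !hornerE subrr.
rewrite hornerM horner_comp !hornerE mulf_eq0 negb_or => /andP[/Hp gt /Hq ht].
apply: iso_trans (eqv_iso gt) (iso_sym _).
have -> : g + t *: (h - g) = h + (1 - t) *: (g - h); last exact: eqv_iso.
by rewrite scalerBl scale1r -(opprB h g) scalerN opprK addrA subKr.
Qed.

End Rigid.

(** * Finiteness *)

Section FiniteClasses.

(** A bounded natural-number code, rather than a map to a finite type, keeps the codomain fixed, so
    that [choice] can pick codes for a whole family. *)
Definition finite_classes T (P : T -> Prop) (E : T -> T -> Prop) : Prop :=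
  exists (N : nat) (inv : T -> nat), (forall g, (inv g < N)%N) /\
    forall g h, P g -> P h -> inv g = inv h -> E g h.

Lemma finite_classes_cover (T : Type) (I : finType) (Q : I -> T -> Prop) P E :
  (forall g, P g -> exists i, Q i g) -> (forall i, finite_classes (Q i) E) ->
  finite_classes P E.
Proof.
move=> cov /choice[N /choice[inv Hinv]].
have /choice[f Hf] g : exists o : option I, P g -> exists2 i, o = Some i & Q i g.
  case: (pselect (P g)) => [/cov[i Qi]|nP]; last by exists None.
  by exists (Some i) => _; exists i.
pose M := (\max_i N i).+1.
pose code g : option (I * 'I_M) := omap (fun i => (i, inord (inv i g))) (f g).
exists #|{: option (I * 'I_M)}|, (fun g => val (enum_rank (code g))); split=> [g|g h]; first exact: ltn_ord.
move=> /Hf[i fi Qi] /Hf[j fj Qj] /val_inj/enum_rank_inj; rewrite /code fi fj => -[ij].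
case: j / ij fj Qj => fj Qj /(congr1 val).
have lt x : (inv i x < M)%N.
  by rewrite ltnS; apply: leq_trans (ltnW ((Hinv i).1 x)) (leq_bigmax i).
by rewrite /= !inordK // => /((Hinv i).2 _ _ Qi Qj).
Qed.

Lemma finite_classes_pair T T1 T2 (x1 : T1) (x2 : T2) (P : T -> Prop) P1 P2 E E1 E2
    (R : T -> T1 -> T2 -> Prop) :
  (forall g, P g -> exists h1 h2, [/\ P1 h1, P2 h2 & R g h1 h2]) ->
  (forall g g' h1 h2 h1' h2', R g h1 h2 -> R g' h1' h2' -> E1 h1 h1' -> E2 h2 h2' -> E g g') ->
  finite_classes P1 E1 -> finite_classes P2 E2 -> finite_classes P E.
Proof.
move=> ex glue [N1 [i1 [lt1 inj1]]] [N2 [i2 [lt2 inj2]]].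
have /choice[f Hf] g : exists h : T1 * T2, P g -> [/\ P1 h.1, P2 h.2 & R g h.1 h.2].
  case: (pselect (P g)) => [/ex[h1 [h2 H]]|nP]; last by exists (x1, x2).
  by exists (h1, h2).
exists #|{: 'I_N1 * 'I_N2}|, (fun g => val (enum_rank (Ordinal (lt1 (f g).1), Ordinal (lt2 (f g).2)))).
split=> [g|g h]; first exact: ltn_ord.
move=> /Hf[p1 p2 Rg] /Hf[q1 q2 Rh] /val_inj/enum_rank_inj[] e1 e2.
exact: glue Rg Rh (inj1 _ _ p1 q1 e1) (inj2 _ _ p2 q2 e2).
Qed.

End FiniteClasses.

Section Finite.
Variable F : closedFieldType.

Lemma dsum_idempotent n (X : obj F n) e : mt X \in unitmx -> hom X X e -> e ** e = e ->
  e <> 0 -> e <> id2 F n -> exists m k (Y : obj F m) (Z : obj F k),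
  [/\ (m < n)%N /\ (k < n)%N, sublabel Y X /\ mt Y \in unitmx, sublabel Z X /\ mt Z \in unitmx &
      dsum X Y Z].
Proof.
move=> uX he ee e0 e1.
have he' : hom X X (id2 F n - e) by apply: homB he; apply: hom_id.
have ee' : (id2 F n - e) ** (id2 F n - e) = id2 F n - e.
  by rewrite cmpBl cmp1l cmpBr cmp1r ee subrr subr0.
have [m [Y [s [t [sY uY [hs ht ts] st]]]]] := split_idempotent uX he ee.
have [k [Z [s' [t' [sZ uZ [hs' ht' ts'] st']]]]] := split_idempotent uX he' ee'.
exists m, k, Y, Z; split=> //.
  rewrite !ltn_neqAle (retract_le ts) (retract_le ts') !andbT; split; apply/eqP.
    by move/retract_eq/(_ ts); rewrite st.
  move/retract_eq/(_ ts'); rewrite st' => E; apply: e0.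
  by apply: (addrI (id2 F n - e)); rewrite subrK addr0 E.
by exists s, t, s', t'; split=> //; rewrite st st' addrC subrK.
Qed.

(** Induction on the size. A decomposable [g] is determined up to isomorphism by the sizes of two
    proper summands, the four index maps placing their labels in [r] and [c], and the classes of the
    summands. *)
Lemma finite_classes_of_qpos n (r c : 'I_n -> label) : qpos r c ->
  finite_classes (fun g : 'M[F]_n => g \in unitmx) (fun g h => iso (Obj r c g) (Obj r c h)).
Proof.
have [l] := ubnP n; elim: l n r c => // l IH n r c; rewrite ltnS => nl q.
pose Q (b : bool) (g : 'M[F]_n) := g \in unitmx /\ (b <-> indec (Obj r c g)).
apply: (finite_classes_cover (Q := Q)) => [g ug|].
  case: (pselect (indec (Obj r c g))) => i; [exists true | exists false]; split=> //.
case; last first.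
  pose Q1 (mk : 'I_n * 'I_n) (g : 'M[F]_n) :=
    exists (Y : obj F mk.1) (Z : obj F mk.2), [/\ sublabel Y (Obj r c g) /\ mt Y \in unitmx,
    sublabel Z (Obj r c g) /\ mt Z \in unitmx & dsum (Obj r c g) Y Z].
  apply: (finite_classes_cover (Q := Q1)) => [g [ug [_ H]]|[m k]].
    have [e [he ee e0 e1]] : exists e,
        [/\ hom (Obj r c g) (Obj r c g) e, e ** e = e, e <> 0 & e <> id2 F n].
      apply: contrapT => nex; suff : false by []; apply: H => e he ee.
      case: (pselect (e = 0)) => [|e0]; [by left | right].
      by apply: contrapT => e1; apply: nex; exists e.
    have [m [k [Y [Z [[mn kn] sY sZ ds]]]]] := dsum_idempotent (X := Obj r c g) ug he ee e0 e1.
    by exists (Ordinal mn, Ordinal kn), Y, Z.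
  pose J := ({ffun 'I_m -> 'I_n} * {ffun 'I_m -> 'I_n} *
             ({ffun 'I_k -> 'I_n} * {ffun 'I_k -> 'I_n}))%type.
  pose R (j : J) (g : 'M[F]_n) (h1 : 'M[F]_m) (h2 : 'M[F]_k) :=
    dsum (Obj r c g) (Obj (r \o j.1.1) (c \o j.1.2) h1) (Obj (r \o j.2.1) (c \o j.2.2) h2).
  pose Q2 (j : J) g := [/\ injective j.1.1, injective j.1.2, injective j.2.1, injective j.2.2 &
    exists h1 h2, [/\ h1 \in unitmx, h2 \in unitmx & R j g h1 h2]].
  apply: (finite_classes_cover (Q := Q2)) => [g|j].
    case=> -[rY cY gY] [[rZ cZ gZ] /=].
    case=> -[[i1 [i2 [/= ii1 ii2 -> ->]]] uY] [[k1 [k2 [/= ik1 ik2 -> ->]]] uZ] ds.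
    have ffE a (f : 'I_a -> 'I_n) : finfun f = f :> ('I_a -> 'I_n) by apply/funext=> x; rewrite ffunE.
    exists (finfun i1, finfun i2, (finfun k1, finfun k2)).
    by rewrite /Q2 /R /= !ffE; split=> //; exists gY, gZ.
  case: (pselect [/\ injective j.1.1, injective j.1.2, injective j.2.1 & injective j.2.2]); last first.
    move=> ninj; exists 1%N, (fun=> 0%N); split=> // g h [? ? ? ? _].
    by case: ninj.
  case=> i1 i2 i3 i4.
  have q1 : qpos (r \o j.1.1) (c \o j.1.2).
    by move=> a u v iu iv; apply: (q a (j.1.1 \o u) (j.1.2 \o v)); apply: inj_comp.
  have q2 : qpos (r \o j.2.1) (c \o j.2.2).
    by move=> a u v iu iv; apply: (q a (j.2.1 \o u) (j.2.2 \o v)); apply: inj_comp.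
  apply: (finite_classes_pair 0 0 (R := R j) _ _ (IH _ _ _ _ q1) (IH _ _ _ _ q2)).
  - by move=> g [_ _ _ _ [h1 [h2 []]]]; exists h1, h2.
  - move=> g g' h1 h2 h1' h2'; exact: iso_dsum.
  - exact: leq_trans (ltn_ord m) nl.
  - exact: leq_trans (ltn_ord k) nl.
case: (posnP n) => [n0|n_gt0].
  exists 1%N, (fun=> 0%N); split=> // g h _ _ _.
  have -> : g = h by apply/matrixP=> i; have := ltn_ord i; rewrite {2}n0.
  by exists (id2 F n), (id2 F n); split; rewrite ?cmp1l //; apply: hom_id.
(* With the labels fixed, indecomposables are rigid and so form at most one class: a constant code
   suffices. *)
exists 1%N, (fun=> 0%N); split=> // g h [ug [/(_ isT) ig _]] [uh [/(_ isT) ih _]] _.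
by apply: rigid_eqv; apply: brick_rigid => //; apply: brick_of_indec.
Qed.

Lemma finitely_many_of_qpos n (r c : 'I_n -> label) : qpos r c -> finitely_many F r c.
Proof.
move=> /finite_classes_of_qpos[N [inv [lt Hinv]]].
exists 'I_N, (fun g => Ordinal (lt g)) => g h ug uh [] e.
exact: iso_eqv (Hinv g h ug uh e).
Qed.

End Finite.

(** * Passing to sub-vectors *)

Section Heredity.
Variable F : fieldType.

Definition inj_mx m n (i : 'I_m -> 'I_n) : 'M[F]_(n, m) := \matrix_(a, b) (a == i b)%:R.

Lemma inj_mx_mulr m n k (i : 'I_m -> 'I_n) (j : 'I_k -> 'I_n) a b :
  ((inj_mx i)^T *m inj_mx j) a b = (i a == j b)%:R.
Proof.
rewrite mxE (bigD1 (i a)) //= !mxE eqxx mul1r big1 ?addr0 // => l /negbTE nl.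
by rewrite !mxE nl mul0r.
Qed.

Lemma inj_mx1 m n (i : 'I_m -> 'I_n) : injective i -> (inj_mx i)^T *m inj_mx i = 1%:M.
Proof. by move=> ii; apply/matrixP=> a b; rewrite inj_mx_mulr mxE (inj_eq ii). Qed.

Lemma pat_inj_mx m n (i : 'I_m -> 'I_n) (r : 'I_n -> label) : pat r (r \o i) (inj_mx i).
Proof. by move=> a b; rewrite mxE; case: (eqVneq a (i b)) => [-> _|_]; rewrite ?lle_refl ?eqxx. Qed.

Lemma pat_inj_mxT m n (i : 'I_m -> 'I_n) (r : 'I_n -> label) : pat (r \o i) r (inj_mx i)^T.
Proof. by move=> b a; rewrite !mxE; case: (eqVneq a (i b)) => [-> _|_]; rewrite ?lle_refl ?eqxx. Qed.

Lemma inj_mx_lift n (i0 : 'I_n.+1) (j0 : 'I_n.+1) :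
  inj_mx (lift i0) *m (inj_mx (lift i0))^T +
  inj_mx (fun _ : 'I_1 => i0) *m (inj_mx (fun _ : 'I_1 => i0))^T = 1%:M.
Proof.
apply/matrixP=> a b; rewrite !mxE big_ord1 !mxE.
case: (unliftP i0 a) => [a' ->|->].
  rewrite (bigD1 a') //= !mxE eqxx mul1r big1 => [|l nl].
    by rewrite [lift i0 a' == i0]eq_sym (negbTE (neq_lift _ _)) mul0r !addr0 eq_sym.
  by rewrite !mxE (inj_eq lift_inj) eq_sym (negbTE nl) mul0r.
rewrite big1 => [|l _]; first by rewrite add0r eqxx mul1r eq_sym.
by rewrite !mxE (negbTE (neq_lift _ _)) mul0r.
Qed.

Lemma retract_mx m n (r c : 'I_n -> label) (g : 'M[F]_n) (h : 'M[F]_m) (i k : 'I_m -> 'I_n) :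
  injective i -> injective k -> inj_mx i *m h = g *m inj_mx k ->
  h *m (inj_mx k)^T = (inj_mx i)^T *m g ->
  retract (Obj r c g) (Obj (r \o i) (c \o k) h) (inj_mx i, inj_mx k) ((inj_mx i)^T, (inj_mx k)^T).
Proof.
move=> ii ik E1 E2; split.
- by split=> //; split; apply: pat_inj_mx.
- by split=> //; split; apply: pat_inj_mxT.
- by rewrite /cmp /= !inj_mx1.
Qed.

(** [G g] is [g] with a summand 1 added in row [i0] and column [j0]; [thin_cancel] recovers the
    class of [g] from that of [G g]. *)
Lemma finitely_many_lift n (r c : 'I_n.+1 -> label) i0 j0 :
  finitely_many F r c -> finitely_many F (r \o lift i0) (c \o lift j0).
Proof.
case=> K [inv Hinv].
pose i1 := fun _ : 'I_1 => i0; pose j1 := fun _ : 'I_1 => j0.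
pose G (g : 'M[F]_n) := inj_mx (lift i0) *m g *m (inj_mx (lift j0))^T + inj_mx i1 *m (inj_mx j1)^T.
have inj1 (a : 'I_n.+1) : injective (fun _ : 'I_1 => a) by move=> x y _; rewrite !ord1.
have o1 (a : 'I_n.+1) : (inj_mx (lift a))^T *m inj_mx (fun _ : 'I_1 => a) = 0.
  by apply/matrixP=> x y; rewrite inj_mx_mulr mxE eq_sym (negbTE (neq_lift _ _)).
have o2 (a : 'I_n.+1) : (inj_mx (fun _ : 'I_1 => a))^T *m inj_mx (lift a) = 0.
  by apply/matrixP=> x y; rewrite inj_mx_mulr mxE (negbTE (neq_lift _ _)).
have GL g : G g *m inj_mx (lift j0) = inj_mx (lift i0) *m g.
  by rewrite mulmxDl -!mulmxA inj_mx1 ?o2 ?mulmx0 ?addr0 ?mulmx1 //; apply: lift_inj.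
have Ge g : G g *m inj_mx j1 = inj_mx i1.
  by rewrite mulmxDl -!mulmxA inj_mx1 ?o1 ?mulmx0 ?add0r ?mulmx1 //; apply: inj1.
have LG g : (inj_mx (lift i0))^T *m G g = g *m (inj_mx (lift j0))^T.
  by rewrite mulmxDr !mulmxA inj_mx1 ?o1 ?mul0mx ?addr0 ?mul1mx //; apply: lift_inj.
have eG g : (inj_mx i1)^T *m G g = (inj_mx j1)^T.
  by rewrite mulmxDr !mulmxA inj_mx1 ?o2 ?mul0mx ?add0r ?mul1mx //; apply: inj1.
have uG g : g \in unitmx -> G g \in unitmx.
  move=> ug; pose H := inj_mx (lift j0) *m invmx g *m (inj_mx (lift i0))^T + inj_mx j1 *m (inj_mx i1)^T.
  suff /mulmx1_unit[] : G g *m H = 1%:M by [].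
  by rewrite mulmxDr !mulmxA GL Ge mulmxK // inj_mx_lift.
have ds g : dsum (Obj r c (G g)) (Obj (r \o lift i0) (c \o lift j0) g) (Obj (r \o i1) (c \o j1) 1%:M).
  exists (inj_mx (lift i0), inj_mx (lift j0)), ((inj_mx (lift i0))^T, (inj_mx (lift j0))^T).
  exists (inj_mx i1, inj_mx j1), ((inj_mx i1)^T, (inj_mx j1)^T); split.
  - by apply: retract_mx; rewrite ?GL ?LG //; apply: lift_inj.
  - by apply: retract_mx; rewrite ?Ge ?eG ?mulmx1 ?mul1mx //; apply: inj1.
  - by rewrite /cmp; apply: injective_projections; apply: inj_mx_lift.
exists K, (inv \o G) => g h ug uh /= E.
apply: iso_eqv; apply: (thin_cancel _ _ (ds g) (ds h)) => //.
by apply/eqv_iso/Hinv; rewrite ?uG.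
Qed.

(** Indices outside the images are dropped one row and one column at a time; once [m = n], the
    injections are permutations and merely relabel objects. *)
Lemma finitely_many_sub m n (r c : 'I_n -> label) (i k : 'I_m -> 'I_n) :
  injective i -> injective k -> finitely_many F r c -> finitely_many F (r \o i) (c \o k).
Proof.
have lift_through a b (f : 'I_a -> 'I_b.+1) : injective f -> (a <= b)%N ->
    exists (x : 'I_b.+1) (f' : 'I_a -> 'I_b), injective f' /\ f = lift x \o f'.
  move=> fi ab; have [x Hx] : exists x : 'I_b.+1, forall y, f y != x.
    apply: contrapT => nx.
    have : (#|[set: 'I_b.+1]%SET| <= #|f @: [set: 'I_a]%SET|)%N.
      apply/subset_leq_card/fintype.subsetP=> x _; apply: contrapT => nfx; apply: nx; exists x => y.
      by apply: contra_notN nfx => /eqP <-; apply: imset_f.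
    by move=> /leq_trans/(_ (leq_imset_card _ _)); rewrite !cardsT !card_ord ltnNge ab.
  have /choice[f' Hf'] y : exists z, f y = lift x z.
    by case: (unliftP x (f y)) (Hx y) => [z ->|->]; [exists z | rewrite eqxx].
  exists x, f'; split; last by apply/funext.
  by move=> y z E; apply: fi; rewrite !Hf' E.
elim: n r c i k => [|n IH] r c i k ii ik fin.
  have m0 : m = 0%N by have := leq_card i ii; rewrite !card_ord leqn0 => /eqP.
  exists 'I_1, (fun=> ord0) => g h _ _ _.
  have -> : g = h by apply/matrixP=> x; have := ltn_ord x; rewrite {2}m0.
  by exists 1%:M, 1%:M; rewrite mul1mx mulmx1 unitmx1; split=> //; split; apply: pat_scalar.
have := leq_card i ii; rewrite !card_ord leq_eqVlt => /orP[/eqP mn|]; last first.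
  rewrite ltnS => mn.
  have [x [i' [ii' ->]]] := lift_through _ _ i ii mn.
  have [y [k' [ik' ->]]] := lift_through _ _ k ik mn.
  exact: IH (r \o lift x) (c \o lift y) i' k' ii' ik' (finitely_many_lift _ _ fin).
case: fin => K [inv Hinv]; move: i k ii ik; rewrite mn => i k ii ik.
have J1 (f : 'I_n.+1 -> 'I_n.+1) : injective f -> inj_mx f *m (inj_mx f)^T = 1%:M.
  by move=> fi; apply: mulmx1C; apply: inj_mx1.
pose G (g : 'M[F]_n.+1) := inj_mx i *m g *m (inj_mx k)^T.
have uJ (f : 'I_n.+1 -> 'I_n.+1) : injective f -> inj_mx f \in unitmx.
  by move/J1/mulmx1_unit=> [].
have uG g : g \in unitmx -> G g \in unitmx.
  by move=> ug; rewrite !unitmx_mul unitmx_tr ug !uJ.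
have GE g : iso (Obj (r \o i) (c \o k) g) (Obj r c (G g)).
  have [hs ht ts] : retract (Obj r c (G g)) (Obj (r \o i) (c \o k) g)
      (inj_mx i, inj_mx k) ((inj_mx i)^T, (inj_mx k)^T).
    apply: retract_mx => //; first by rewrite /G -!mulmxA inj_mx1 // mulmx1.
    by rewrite /G !mulmxA inj_mx1 // mul1mx.
  by exists (inj_mx i, inj_mx k), ((inj_mx i)^T, (inj_mx k)^T); split=> //; exact: (retract_eq erefl ts).
exists K, (inv \o G) => g h ug uh /= E; apply: iso_eqv.
apply: iso_trans (GE g) (iso_trans _ (iso_sym (GE h))).
by apply/eqv_iso/Hinv; rewrite ?uG.
Qed.

End Heredity.

(** * The numerical classification *)

Section Compositions.
Implicit Types a b c s : seq nat.
Local Open Scope nat_scope.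

Definition sq s := sumn [seq x * x | x <- s].

Definition below (s' s : seq nat) := size s' = size s /\ forall k, nth 0 s' k <= nth 0 s k.

(** Twice the Tits form, to avoid halves; the condition on the sums characterizes dimension vectors
    of objects. *)
Definition positive_form a b c : Prop := forall a' b' c',
  below a' a -> below b' b -> below c' c -> sumn c' = sumn a' + sumn b' -> 0 < sumn c' ->
  2 * (sumn a' * sumn b') < sq a' + sq b' + sq c'.

(** The cases of [classified] read on compositions, [PA_1] being split into three. Conditions on the
    minimum become membership: if 2 occurs in [c] together with 1, then [fin_3_min1] applies. *)
Variant finite_list a b c : Prop :=
| fin_11 of size a = 1 & size b = 1
| fin_mir1 of size a = 2 & 1 \in a & size b = 1
| fin_mir2 of size a = 1 & size b = 2 & 1 \in b
| fin_b1 of size b = 1 & sumn b = 1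
| fin_max_b2 of size a = 2 & size b = 1 & sumn b = 2
| fin_6 of size c <= 6 & size a = 2 & size b = 1
| fin_4_4 of size c <= 4 & size a <= 4 & size b = 1
| fin_4_min of size c <= 4 & 1 \in c & size b = 1
| fin_4_b2 of size c <= 4 & size b = 1 & sumn b = 2
| fin_3_min1 of size c <= 3 & 1 \in c
| fin_3_min2 of size c <= 3 & 2 \in c & size b <= 2
| fin_3_b of size c <= 3 & size b = 1 \/ size b = 2 /\ 1 \in b
| fin_3_4_2 of size c <= 3 & size a <= 4 & size b = 2
| fin_2 of size c <= 2.

Lemma sq_ge_sumn s : sumn s <= sq s.
Proof.
elim: s => //= x s; rewrite /sq /= => IH; apply: leq_add IH.
by case: x => // x; rewrite leq_pmulr.
Qed.

Lemma sumn_sqr_le s : sumn s * sumn s <= size s * sq s.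
Proof.
elim: s => //= x s; rewrite /sq /=; set k := size s; set S := sumn s; set Q := sumn _ => IH.
have h : 2 * (x * S) <= k * (x * x) + Q.
  case: (posnP k) => [k0|k0].
    by move: IH; rewrite k0 mul0n leqn0 muln_eq0 orbb => /eqP->; rewrite muln0.
  rewrite -(leq_pmul2l k0).
  have C : k * (2 * (x * S)) <= k * x * (k * x) + S * S.
    by have := (nat_Cauchy (k * x) S).1; rewrite -!mulnn; lia.
  apply: leq_trans C _; have -> : k * (k * (x * x) + Q) = k * x * (k * x) + k * Q by lia.
  by rewrite leq_add2l.
lia.
Qed.

Lemma sumn_sqr_le_size k s : size s <= k -> sumn s * sumn s <= k * sq s.
Proof. by move=> sk; apply: leq_trans (sumn_sqr_le s) _; rewrite leq_mul2r sk orbT. Qed.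

(** Cauchy-Schwarz for the parts other than [x]. *)
Lemma sumn_sqr_mem k s x : x \in s -> size s <= k.+1 ->
  exists S, [/\ sumn s = x + S, x * x <= sq s & S * S <= k * (sq s - x * x)].
Proof.
move=> xs sk; have p := perm_to_rem xs; exists (sumn (rem x s)).
have qE : sq s = x * x + sq (rem x s) by rewrite /sq (perm_sumn (perm_map _ p)).
rewrite (perm_sumn p) qE leq_addr addKn; split=> //; apply: sumn_sqr_le_size.
by rewrite size_rem // -ltnS prednK //; case: (s) xs.
Qed.

Lemma below_mem s' s x : below s' s -> x \in s -> exists2 y, y \in s' & y <= x.
Proof.
case=> es le xs; exists (nth 0 s' (index x s)); first by rewrite mem_nth // es index_mem.
by apply: leq_trans (le _) _; rewrite nth_index.
Qed.

Lemma below_sumn s' s : below s' s -> sumn s' <= sumn s.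
Proof.
elim: s' s => [|x s' IH] [|y s] [] //= [es] le.
by apply: leq_add; [apply: (le 0) | apply: IH; split=> // k; apply: (le k.+1)].
Qed.

Lemma size1_sumn s : size s = 1 -> sq s = sumn s * sumn s.
Proof. by case: s => [|x []] //= _; rewrite /sq /= !addn0. Qed.

(** Cauchy-Schwarz bounds the sums of squares below by quadratic forms in the sums p of [a'] and q
    of [b']. Strictness comes from definiteness, from [sumn <= sq], or from integrality through
    [AG']. *)
Lemma positive_of_list a b c : finite_list a b c -> positive_form a b c.
Proof.
move=> H a' b' c' [ea la] [eb lb] [ec lc] E pos.
have ba : below a' a by []. have bb : below b' b by []. have bc : below c' c by [].
have A1 := sq_ge_sumn a'; have B1 := sq_ge_sumn b'; have C1 := sq_ge_sumn c'.
have AG x y : 2 * (x * y) <= x * x + y * y.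
  by have := (nat_Cauchy x y).1; rewrite -!mulnn.
(* (x - y)^2 >= x - y over the integers. *)
have AG' x y : 2 * (x * y) + x <= x * x + y * y + y.
  case: (leqP x y) => [xy|yx]; first by have := AG x y; lia.
  have -> : x = y + (x - y).-1.+1 by lia.
  by move: (x - y).-1 => d; have := leq0n (d * d); lia.
have CA k := @sumn_sqr_le_size k a'; have CB k := @sumn_sqr_le_size k b'.
have CC k := @sumn_sqr_le_size k c'.
have qb := below_sumn bb.
case: H; rewrite -?ea -?eb -?ec.
- by move=> /size1_sumn A /size1_sumn B; have := AG (sumn a') (sumn b'); lia.
- move=> sa /(below_mem ba)[y ya y1] /size1_sumn B.
  have [S [aE Ay aS]] := sumn_sqr_mem (k := 1) ya (eq_leq sa).
  have := AG' (sumn b') S; have := AG (sumn b') S.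
  case: y y1 {ya} aE Ay aS => [|[|//]] _ aE Ay aS; rewrite aE in E *; lia.
- move=> /size1_sumn A sb /(below_mem bb)[y yb y1].
  have [S [bE By bS]] := sumn_sqr_mem (k := 1) yb (eq_leq sb).
  have := AG' (sumn a') S; have := AG (sumn a') S.
  case: y y1 {yb} bE By bS => [|[|//]] _ bE By bS; rewrite bE in E *; lia.
- move=> /size1_sumn B b1; rewrite b1 in qb.
  by case: (sumn b') qb B E => [|[|//]] _ B E; lia.
- move=> sa /size1_sumn B b2; rewrite b2 in qb.
  case: a' sa {ea la ba CA} A1 E => [|x [|y []]] //= _ A1 E.
  have -> : sq [:: x; y] = x * x + y * y by rewrite /sq /= addn0.
  rewrite addn0 in E A1 *.
  have := AG' x 1; have := AG' y 1; have := AG x 1; have := AG y 1.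
  by case: (sumn b') qb B E => [|[|[|//]]] _ B E; lia.
- move=> /CC{}CC /eq_leq/CA{}CA /size1_sumn B; rewrite E in CC.
  case: (posnP (sumn b')) => [q0|q0]; first by rewrite q0 muln0; lia.
  (* Six times the lower bound for the difference of the two sides is 4p^2 - 10pq + 7q^2, and four
     times this is (4p - 5q)^2 + 3q^2. The weights 2, 3 and 7, 8 below complete squares in the same
     way. *)
  have := AG (4 * sumn a') (5 * sumn b'); have := leq_mul q0 q0; lia.
- move=> /CC{}CC /CA{}CA /size1_sumn B; rewrite E in CC.
  case: (posnP (sumn b')) => [q0|q0]; first by rewrite q0 muln0; lia.
  have := AG (2 * sumn a') (3 * sumn b'); have := leq_mul q0 q0; lia.
- move=> sc /(below_mem bc)[y yc y1] /size1_sumn B.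
  case: (posnP (sumn a')) => [p0|p0]; first by rewrite p0 mul0n; lia.
  have [S [cE Cy cS]] := sumn_sqr_mem (k := 3) yc sc.
  have e2 := congr2 muln (esym E) (esym E); rewrite cE in e2.
  have := AG' (2 * sumn b') (sumn a'); have := AG (2 * sumn b') (sumn a').
  case: y y1 {yc} cE e2 Cy cS => [|[|//]] _ cE e2 Cy cS; lia.
- move=> /CC{}CC /size1_sumn B b2; rewrite b2 in qb; rewrite E in CC.
  have := AG (sumn a') 4; have := AG (sumn a') 1.
  by case: (sumn b') qb B E CC => [|[|[|//]]] _ B E CC; lia.
- move=> sc /(below_mem bc)[y yc y1].
  have [S [cE Cy cS]] := sumn_sqr_mem (k := 2) yc sc.
  have e2 := congr2 muln (esym E) (esym E); rewrite cE in e2.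
  have := AG (sumn a') (sumn b').
  case: y y1 {yc} cE e2 Cy cS => [|[|//]] _ cE e2 Cy cS; lia.
- move=> sc /(below_mem bc)[y yc y2] /CB{}CB.
  have [S [cE Cy cS]] := sumn_sqr_mem (k := 2) yc sc.
  have e2 := congr2 muln (esym E) (esym E); rewrite cE in e2.
  have := AG (sumn a') (sumn b'); have := AG (sumn a') (sumn b').+1; have := AG (sumn b') 3.
  case: y y2 {yc} cE e2 Cy cS => [|[|[|//]]] _ cE e2 Cy cS; lia.
- move=> /CC{}CC; rewrite E in CC.
  have AG1 := AG (2 * sumn b') (sumn a').
  case: (posnP (sumn a')) => [p0|p0]; first by rewrite p0 mul0n; lia.
  case=> [/size1_sumn B|[sb /(below_mem bb)[y yb y1]]]; first by lia.
  have [S [bE By bS]] := sumn_sqr_mem (k := 1) yb (eq_leq sb).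
  have := AG' (2 * sumn b') (sumn a').+1.
  case: y y1 {yb} bE By bS => [|[|//]] _ bE By bS; rewrite bE in AG1 CC *; lia.
- move=> /CC{}CC /CA{}CA /eq_leq/CB{}CB; rewrite E in CC.
  case: (posnP (sumn b')) => [q0|q0]; first by rewrite q0 muln0; lia.
  have := AG (7 * sumn a') (8 * sumn b'); have := leq_mul q0 q0; lia.
- move=> /CC{}CC; rewrite E in CC; have := AG (sumn a') (sumn b'); lia.
Qed.

(* The sub-vector with N_i parts all equal to v_i has nonpositive Tits form. *)
Definition negative_form a b c : Prop := exists N1 v1 N2 v2 N3 v3,
  [/\ [/\ N1 <= size a, N2 <= size b & N3 <= size c],
      [/\ all (leq v1) a, all (leq v2) b & all (leq v3) c],
      N3 * v3 = N1 * v1 + N2 * v2, 0 < N3 * v3 &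
      N1 * (v1 * v1) + N2 * (v2 * v2) + N3 * (v3 * v3) <= 2 * ((N1 * v1) * (N2 * v2))].

Lemma negative_formC a b c : negative_form a b c -> negative_form b a c.
Proof.
case=> N1 [v1 [N2 [v2 [N3 [v3 [[sa sb sc] [la lb lc] E pos le]]]]]].
exists N2, v2, N1, v1, N3, v3; split=> //; first by rewrite addnC.
by rewrite (mulnC (N2 * v2)) (addnC (N2 * (v2 * v2))).
Qed.

Lemma all_leqS v s : all (leq v) s -> v \notin s -> all (leq v.+1) s.
Proof.
move=> /allP h ns; apply/allP=> x xs; rewrite ltn_neqAle h // andbT.
by apply: contraNneq ns => ->.
Qed.

(** Each test either lands in the list or raises a number of parts or, by [all_leqS], a lower bound
    on the parts, until a critical vector fits underneath. The arguments of [bad] give that vector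
    as multiplicity and value for each of its three members. *)
Lemma finite_list_or_negative a b c : 0 < size a -> 0 < size b ->
  all (leq 1) a -> all (leq 1) b -> all (leq 1) c ->
  [\/ finite_list a b c, finite_list b a c | negative_form a b c].
Proof.
move=> a0 b0 pa pb pc.
have bad N1 v1 N2 v2 N3 v3 x y z : N1 <= size x -> N2 <= size y -> N3 <= size z ->
    all (leq v1) x -> all (leq v2) y -> all (leq v3) z ->
    [&& N3 * v3 == N1 * v1 + N2 * v2, 0 < N3 * v3 &
     N1 * (v1 * v1) + N2 * (v2 * v2) + N3 * (v3 * v3) <= 2 * ((N1 * v1) * (N2 * v2))] ->
    negative_form x y z.
  by move=> ? ? ? ? ? ? /and3P[/eqP ? ? ?]; exists N1, v1, N2, v2, N3, v3.
have sym (P : seq nat -> seq nat -> Prop) :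
    (forall x y, 0 < size x -> 0 < size y -> all (leq 1) x -> all (leq 1) y -> P x y ->
     finite_list x y c \/ negative_form x y c) -> P a b \/ P b a ->
    [\/ finite_list a b c, finite_list b a c | negative_form a b c].
  move=> H [/(H a b a0 b0 pa pb)[?|?]|/(H b a b0 a0 pb pa)[?|/negative_formC ?]];
    by [constructor 1 | constructor 2 | constructor 3].
case: (leqP (size c) 2) => c2; first by constructor 1; constructor.
case: (leqP (size c) 3) => c3.
{ case: (boolP (1 \in c)) => [c1|/(all_leqS pc) {}pc]; first by constructor 1; constructor 10.
  case: (leqP 3 (size a)) => a3; first case: (leqP 3 (size b)) => b3.
  - by constructor 3; apply: (bad 3 1 3 1 3 2).
  all: apply: (sym (fun x y => size y <= 2)); last by [left; rewrite -ltnS | right; rewrite -ltnS].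
  all: move=> x y x0 y0 px py; rewrite leq_eqVlt ltnS => /orP[/eqP y2|y1]; last first.
  1,3: by left; constructor 12 => //; left; apply/eqP; rewrite eqn_leq y1 y0.
  all: case: (boolP (2 \in c)) => [c4|/(all_leqS pc) pc'];
    first by left; constructor 11; rewrite ?y2.
  all: case: (boolP (1 \in y)) => [y4|/(all_leqS py) py'];
    first by left; constructor 12 => //; right.
  all: case: (leqP (size x) 4) => x4; first by left; constructor 13.
  all: by right; apply: (bad 5 1 2 2 3 3); rewrite ?y2. }
case: (leqP 2 (size a)) => a2; first case: (leqP 2 (size b)) => b2.
- by constructor 3; apply: (bad 2 1 2 1 4 1).
all: apply: (sym (fun x y => size y <= 1)); last by [left; rewrite -ltnS | right; rewrite -ltnS].
all: move=> x y x0 y0 px py y1'; have y1 : size y = 1 by apply/eqP; rewrite eqn_leq y1' y0.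
all: have yE : y = [:: sumn y] by case: (y) y1 => [|u []] //= _; rewrite addn0.
all: case: (eqVneq (sumn y) 1) => [s1|s1]; first by left; constructor 4.
all: have ge2 : 2 <= sumn y by move: py; rewrite yE /= addn0 andbT leq_eqVlt eq_sym (negbTE s1).
all: case: (leqP (size x) 1) => x1; first by left; constructor 1 => //; apply/eqP; rewrite eqn_leq x1 x0.
all: case: (leqP (size c) 4) => c4.
1,3: case: (leqP (size x) 4) => x4; first by left; constructor 7.
1,2: case: (boolP (1 \in c)) => [c1|/(all_leqS pc) pc']; first by left; constructor 8.
1,2: case: (eqVneq (sumn y) 2) => [s2|s2]; first by left; constructor 9.
1,2: by right; apply: (bad 5 1 1 3 4 2); rewrite ?y1 // yE /= andbT ltn_neqAle eq_sym s2.
all: case: (leqP 3 (size x)) => x3;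
  first by right; apply: (bad 3 1 1 2 5 1); rewrite ?y1 // yE /= andbT.
all: have x2 : size x = 2 by apply/eqP; rewrite eqn_leq x1 -ltnS x3.
all: case: (leqP (size c) 6) => c6; first by left; constructor 6.
all: case: (boolP (1 \in x)) => [x4|/(all_leqS px) px']; first by left; constructor 2.
all: case: (eqVneq (sumn y) 2) => [s2|s2]; first by left; constructor 5.
all: by right; apply: (bad 2 2 1 3 7 1); rewrite ?x2 ?y1 // yE /= andbT ltn_neqAle eq_sym s2.
Qed.
End Compositions.

(** * From block sizes to labels *)

Section Counting.
Local Open Scope nat_scope.

Definition cnt n (l : 'I_n -> label) (s : bool) (k : nat) : nat := #|[set i | l i == (s, k)]|.

Lemma sumn_mkseq (f : nat -> nat) k : sumn (mkseq f k) = \sum_(i < k) f i.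
Proof. by rewrite sumnE /mkseq big_map -[X in iota 0 X]subn0 -/(index_iota 0 k) big_mkord. Qed.

Lemma sq_mkseq (f : nat -> nat) k : sq (mkseq f k) = \sum_(i < k) f i * f i.
Proof. by rewrite /sq -map_comp sumn_mkseq. Qed.

Lemma cntE n (l : 'I_n -> label) s k : cnt l s k = \sum_i (l i == (s, k)).
Proof. by rewrite /cnt -sum1dep_card big_mkcond /=. Qed.

(** Symmetrization: [lle x y + lle y x] is 1 for labels of one chain, plus 1 if they are equal. Over
    ordered pairs, the first term sums to the squares of the chain lengths, the second to the
    squares of the block sizes. *)
Lemma npat_cnt n (l : 'I_n -> label) A B :
  (forall i, (l i).2 < if (l i).1 then A else B) ->
  let a := mkseq (cnt l true) A in let b := mkseq (cnt l false) B in
  n = sumn a + sumn b /\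
  2 * npat l = sumn a * sumn a + sq a + (sumn b * sumn b + sq b).
Proof.
move=> lb a b.
pose m s := \sum_i ((l i).1 == s).
have side i : forall s K, ((l i).1 == s -> (l i).2 < K) ->
    \sum_(k < K) (l i == (s, k : nat)) = ((l i).1 == s).
  move=> s K lK; case: eqP lK => [ls|ls] lK.
    rewrite (bigD1 (Ordinal (lK isT))) //= big1 ?addn0 => [|k nk].
      by have -> : l i == (s, (l i).2) by rewrite -ls -surjective_pairing.
    by apply/eqP; rewrite eqb0; apply: contra nk => /eqP E; apply/eqP/val_inj; rewrite /= E.
  by rewrite big1 // => k _; apply/eqP; rewrite eqb0; apply/eqP => E; apply: ls; rewrite E.
have lA i : (l i).1 == true -> (l i).2 < A by move/eqP=> E; have := lb i; rewrite E.
have lB i : (l i).1 == false -> (l i).2 < B by move/eqP=> E; have := lb i; rewrite E.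
have sa : sumn a = m true.
  rewrite sumn_mkseq; under eq_bigr do rewrite cntE.
  by rewrite exchange_big; apply: eq_bigr => i _; exact: (side i true A (lA i)).
have sb : sumn b = m false.
  rewrite sumn_mkseq; under eq_bigr do rewrite cntE.
  by rewrite exchange_big; apply: eq_bigr => i _; exact: (side i false B (lB i)).
split.
  rewrite sa sb -big_split /= -[LHS]card_ord -sum1_card; apply: eq_bigr => i _.
  by case: (l i).1.
have -> : npat l = \sum_i \sum_j lle (l i) (l j).
  by rewrite /npat -sum1dep_card big_mkcond /= pair_bigA.
have -> : 2 * (\sum_i \sum_j lle (l i) (l j)) =
    \sum_i \sum_j (((l i).1 == (l j).1) + (l i == l j)).
  rewrite mul2n -addnn {2}exchange_big -big_split; apply: eq_bigr => i _ /=.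
  rewrite -big_split; apply: eq_bigr => j _ /=.
  case: (l i) (l j) => [s k] [s' k']; rewrite /lle /= xpair_eqE [s' == s]eq_sym.
  by case: (s == s') => //=; case: ltngtP.
have sqE s K (lK : forall i, (l i).1 == s -> (l i).2 < K) :
    \sum_(k < K) cnt l s k * cnt l s k = \sum_i \sum_j (((l i).1 == s) && (l i == l j)).
  transitivity (\sum_(k < K) \sum_i \sum_j (l i == (s, k : nat)) * (l j == (s, k : nat))).
    by apply: eq_bigr => k _; rewrite cntE big_distrlr.
  rewrite exchange_big; apply: eq_bigr => i _; rewrite exchange_big; apply: eq_bigr => j _ /=.
  case: (eqVneq (l i) (l j)) => [<-|nij].
    rewrite andbT -(side i s K); last exact: lK.
    apply: eq_bigr => k _; by case: eqP.
  rewrite andbF big1 // => k _; case: eqP => // E; case: eqP => // E'.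
  by case/eqP: nij; rewrite E E'.
rewrite !sq_mkseq (sqE _ _ lA) (sqE _ _ lB) sa sb /m !big_distrlr /= addnACA.
rewrite -!big_split; apply: eq_bigr => i _ /=; rewrite -!big_split; apply: eq_bigr => j _ /=.
by case: (l i) (l j) => [[] k] [[] k'] /=; rewrite ?addn0.
Qed.

Lemma cnt_comp m n (l : 'I_n -> label) (i : 'I_m -> 'I_n) s k :
  injective i -> cnt (l \o i) s k <= cnt l s k.
Proof.
move=> ii; rewrite /cnt -(card_imset _ ii); apply/subset_leq_card/fintype.subsetP=> x.
by case/imsetP=> y; rewrite !inE => ly ->.
Qed.

Lemma sublabel_with_cnt n (l : 'I_n -> label) (t : label -> nat) :
  (forall x, t x <= cnt l x.1 x.2) ->
  exists m (i : 'I_m -> 'I_n), injective i /\ forall s k, cnt (l \o i) s k = t (s, k).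
Proof.
move=> tl.
pose B x := [set i in take (t x) (enum [set i | l i == x])].
have Bl x i : i \in B x -> l i = x.
  by rewrite inE => /mem_take; rewrite mem_enum inE => /eqP.
have cB x : #|B x| = t x.
  rewrite cardsE (card_uniqP _) ?take_uniq ?enum_uniq // size_takel // -cardE.
  by case: x => s k; apply: tl (s, k).
pose S := [set i | i \in B (l i)].
exists #|S|, (@enum_val _ (mem S)); split; first exact: enum_val_inj.
move=> s k; rewrite -cB /cnt -(card_imset _ (@enum_val_inj _ (mem S))).
apply: eq_card => i; apply/imsetP/idP => [[j]|iB].
  by rewrite inE /= => /eqP lj ->; have := enum_valP j; rewrite inE lj.
have iS : i \in S by rewrite inE (Bl _ _ iB).
by exists (enum_rank_in iS i); rewrite ?inE /= enum_rankK_in // (Bl _ _ iB).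
Qed.

(* [r] labels the rows by two chains with block sizes a and b, and [c] labels the columns
   by a single chain with block sizes d. *)
Definition profile n (r c : 'I_n -> label) (a b d : seq nat) : Prop :=
  [/\ forall k, cnt r true k = nth 0 a k, forall k, cnt r false k = nth 0 b k,
      forall k, cnt c true k = nth 0 d k & forall k, cnt c false k = 0].

Lemma cnt_bound n (l : 'I_n -> label) a b : (forall k, cnt l true k = nth 0 a k) ->
  (forall k, cnt l false k = nth 0 b k) ->
  forall i, (l i).2 < if (l i).1 then size a else size b.
Proof.
move=> ha hb i; have : 0 < cnt l (l i).1 (l i).2.
  by rewrite /cnt card_gt0; apply/set0Pn; exists i; rewrite inE -surjective_pairing.
by case: (l i).1; rewrite ?ha ?hb; apply: contraTT; rewrite -leqNgt => /(nth_default _)->.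
Qed.

Lemma qpos_of_positive n (r c : 'I_n -> label) a b d :
  profile r c a b d -> positive_form a b d -> qpos r c.
Proof.
case=> ra rb cd c0 pos m i k ii ik m0.
have rbd := cnt_bound ra rb; have cbd : forall x, (c x).2 < if (c x).1 then size d else 0.
  by apply: (cnt_bound (b := [::])) => // x; rewrite nth_nil.
have [mr qr] := @npat_cnt _ (r \o i) _ _ (fun x => rbd (i x)).
have [mc qc] := @npat_cnt _ (c \o k) _ _ (fun x => cbd (k x)).
have bel s (l : 'I_n -> label) (j : 'I_m -> 'I_n) e : injective j ->
    (forall x, cnt l s x = nth 0 e x) -> below (mkseq (cnt (l \o j) s) (size e)) e.
  move=> ij le; split=> [|x]; first by rewrite size_mkseq.
  case: (ltnP x (size e)) => xe; last by rewrite nth_default ?size_mkseq.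
  by rewrite nth_mkseq // -le; apply: cnt_comp.
have /= := pos _ _ _ (bel _ _ _ _ ii ra) (bel _ _ _ _ ii rb) (bel _ _ _ _ ik cd).
rewrite [mkseq _ 0]/mkseq /= addn0 in mc; rewrite [mkseq _ 0]/mkseq [sq [::]]/sq /= in qc.
rewrite -mc => /(_ mr m0); move: qr qc; rewrite -mc.
move: (sq _) (sq _) (sq _) => A B D; move: (congr2 muln mr mr); move: (sumn _) (sumn _) => p q ? ? ?; lia.
Qed.

(** The critical vector is cut out of the labels by injections [i] and [j], whose sources have equal
    size by the equality of sums; [infinite_of_npat] applies there. *)
Lemma infinite_of_negative (F : closedFieldType) n (r c : 'I_n -> label) a b d :
  profile r c a b d -> negative_form a b d -> ~ finitely_many F r c.
Proof.
case=> ra rb cd c0 [N1 [v1 [N2 [v2 [N3 [v3 [[s1 s2 s3] [l1 l2 l3] E pos le]]]]]]] fin.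
pose t N v (k : nat) := if k < N then v else 0.
have tle N v (e : seq nat) k : N <= size e -> all (leq v) e -> t N v k <= nth 0 e k.
  rewrite /t; case: ifP => // kN Ne /(all_nthP 0) h; apply: h; exact: leq_trans kN Ne.
have tsum (f : nat -> nat) N v K : (forall x, f x = t N v x) -> N <= K ->
    sumn (mkseq f K) = N * v /\ sq (mkseq f K) = N * (v * v).
  move=> ft NK; rewrite sumn_mkseq sq_mkseq.
  have sumt u : \sum_(x < K) (if x < N then u else 0) = N * u.
    by rewrite -big_mkcond -(big_ord_widen _ (fun=> u)) // sum_nat_const card_ord.
  split; rewrite -sumt; apply: eq_bigr => x _; rewrite ft /t //.
  by case: ifP => //; rewrite muln0.
have [m [i [ii ci]]] : exists m (i : 'I_m -> 'I_n), injective i /\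
    forall s k, cnt (r \o i) s k = if s then t N1 v1 k else t N2 v2 k.
  apply: (sublabel_with_cnt (t := fun x => if x.1 then t N1 v1 x.2 else t N2 v2 x.2)).
  by case=> [[] k] /=; rewrite ?ra ?rb; apply: tle.
have [m' [j [ij cj]]] : exists m (i : 'I_m -> 'I_n), injective i /\
    forall s k, cnt (c \o i) s k = if s then t N3 v3 k else 0.
  apply: (sublabel_with_cnt (t := fun x => if x.1 then t N3 v3 x.2 else 0)).
  by case=> [[] k] //=; rewrite cd; apply: tle.
have rbd := cnt_bound ra rb; have cbd : forall x, (c x).2 < if (c x).1 then size d else 0.
  by apply: (cnt_bound (b := [::])) => // x; rewrite nth_nil.
have [mr qr] := @npat_cnt _ (r \o i) _ _ (fun x => rbd (i x)).
have [mc qc] := @npat_cnt _ (c \o j) _ _ (fun x => cbd (j x)).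
have [A1 A2] := tsum _ N1 v1 (size a) (ci true) s1.
have [B1 B2] := tsum _ N2 v2 (size b) (ci false) s2.
have [D1 D2] := tsum _ N3 v3 (size d) (cj true) s3.
rewrite A1 B1 in mr; rewrite A1 A2 B1 B2 in qr.
rewrite [mkseq _ 0]/mkseq /= D1 addn0 E in mc; rewrite [mkseq _ 0]/mkseq /= D1 D2 in qc.
have mm : m' = m by rewrite mc mr.
case: m / mm i ii ci mr qr A1 A2 B1 B2 => i ii ci mr qr _ _ _ _.
apply: (infinite_of_npat (r := r \o i) (c := c \o j)); last exact: finitely_many_sub fin.
  by rewrite mr -E.
have mm := congr2 muln mr mr; move: qr qc le mm; rewrite E.
move: (N1 * v1) (N2 * v2) (N1 * (v1 * v1)) (N2 * (v2 * v2)) (N3 * (v3 * v3)) => p q A B D.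
rewrite /sq /=; lia.
Qed.
End Counting.

(** * Double flag varieties as double coset spaces *)

Section AdaptedBasis.
Variables (F : fieldType) (m : nat).
Local Notation V := 'cV[F]_m.
Implicit Types (U W : {vspace V}) (R : parabolic F m) (g : 'M[F]_m).

(** Each step adjoins a basis of a complement of the previous one; [U] and [X] are arbitrary for the
    induction. *)
Lemma flag_blocks U s X : path (@strict_subspace F m) U s -> basis_of U X ->
  exists B : seq (seq V), [/\ shape B = pairmap (fun U W => \dim W - \dim U)%N U s,
    basis_of (last U s) (X ++ flatten B) &
    forall k, (k <= size s)%N -> nth U (U :: s) k = (U + <<flatten (take k B)>>)%VS].
Proof.
elim: s U X => [|W s IH] U X /=.
  by move=> _ bX; exists [::]; split; rewrite ?cats0 // => -[|//] _; rewrite span_nil addv0.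
case/andP=> /andP[UW _] pth bX.
have WE : (U + (W :\: U))%VS = W by rewrite addvC addv_diff; apply/addv_idPl.
have bX' : basis_of W (X ++ vbasis (W :\: U)).
  rewrite -{1}WE; apply: cat_basis bX (vbasisP _).
  by rewrite directv_addE directv_trivial ?directvE //= capvC capv_diff !eqxx.
have [B [shB bB nthB]] := IH _ _ pth bX'.
exists (tval (vbasis (W :\: U)) :: B); split.
- rewrite /= shB; congr (_ :: _); rewrite size_tuple.
  by rewrite -[X in _ = (X - _)%N](dimv_cap_compl W U) (capv_idPr UW) addKn.
- by rewrite /= catA.
- case=> [|k] /= ks; first by rewrite span_nil addv0.
  rewrite span_cat (span_basis (vbasisP _)) addvA WE -nthB //=.
  case: k ks => //= k ks; exact: set_nth_default.
Qed.

(** The columns of [z] run through bases of successive complements in the flag, and [lam i] is the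
    step, counted from 0, at which column [i] enters. *)
Lemma adapted_basis R : exists (z : 'M[F]_m) (lam : 'I_m -> nat), [/\ z \in unitmx,
    forall k, #|[set i | lam i == k]%SET| = nth 0%N (composition R) k &
    forall g, stab R g <->
      g \in unitmx /\ pat (fun i => (true, lam i)) (fun i => (true, lam i)) (invmx z *m g *m z)].
Proof.
case: R => s sP; have /andP[pth /eqP lst] := sP.
have [B [shB bB nthB]] := flag_blocks pth (nil_basis _).
rewrite cat0s lst in bB.
have szY : size (flatten B) = m.
  by have := size_basis (X := in_tuple (flatten B)) bB; rewrite dimvf /dim /= muln1 => E; rewrite [RHS]E.
have szB : size B = size s by rewrite -(size_map size) -/(shape B) shB size_pairmap.
pose lam (i : 'I_m) := reshape_index (shape B) i.
pose Y : m.-tuple V := Tuple (introT eqP szY).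
have sumB : sumn (shape B) = m by rewrite -size_flatten.
pose z : 'M[F]_m := \matrix_(a, i) Y`_i a 0.
have zE (u : V) : z *m u = \sum_i u i 0 *: Y`_i.
  apply/matrixP=> a b; rewrite !ord1 mxE summxE; apply: eq_bigr => i _.
  by rewrite !mxE mulrC.
have uz : z \in unitmx.
  rewrite -unitmx_tr -row_free_unit -kermx_eq0; apply/rowV0P => v /sub_kermxP.
  move/(congr1 trmx); rewrite trmx_mul trmxK trmx0 zE => /(freeP (X := Y) (basis_free bB)) v0.
  by apply/matrixP=> a i; rewrite ord1 mxE -(v0 i) mxE.
have zY (i : 'I_m) : invmx z *m Y`_i = delta_mx i 0.
  apply: (can_inj (mulKmx uz)); rewrite mulKVmx // zE (bigD1 i) //= big1 => [|j ji].
    by rewrite mxE !eqxx scale1r addr0.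
  by rewrite mxE (negbTE ji) scale0r.
have lamB (i : 'I_m) : (lam i < size s)%N.
  by rewrite -szB -(size_map size); apply: reshape_indexP; rewrite sumB.
(* Entry 0 of [0%VS :: s] is the zero subspace, so entry [k] is spanned by the basis vectors with
   [lam i < k]. *)
have memF (k : nat) (v : V) : (k <= size s)%N ->
    (v \in nth 0%VS (0%VS :: s) k) = [forall i : 'I_m, (k <= lam i)%N ==> ((invmx z *m v) i 0 == 0)].
  move=> ks; rewrite nthB // add0v; apply/idP/forallP => [vk i|H].
    apply/implyP=> ki; rewrite (coord_span (X := in_tuple _) vk) mulmx_sumr summxE.
    apply/eqP; apply: big1 => j _; rewrite -scalemxAr mxE.
    have /flattenP[bl blB xbl] : (in_tuple (flatten (take k B)))`_j \in flatten (take k B).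
      by apply: mem_nth.
    set x := _`_j in xbl *.
    have [rr rk blE] : exists2 rr, (rr < k)%N & bl = nth [::] B rr.
      have lt : (index bl (take k B) < k)%N.
        by apply: leq_trans (_ : size (take k B) <= k)%N; rewrite ?index_mem // size_take_min geq_minl.
      by exists (index bl (take k B)); rewrite // -(nth_take [::] lt) nth_index.
    have cc : (index x bl < nth 0 (shape B) rr)%N.
      by rewrite (nth_map [::]) ?szB ?(leq_trans rk) // -blE index_mem.
    have fm : (flatten_index (shape B) rr (index x bl) < m)%N by rewrite -[X in (_ < X)%N]sumB; apply: flatten_indexP.
    have -> : x = Y`_(Ordinal fm).
      by rewrite /= nth_flatten flatten_indexKl // flatten_indexKr // -blE nth_index.
    rewrite zY mxE; case: eqP => [ij|_]; last by rewrite mulr0.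
    by move: ki; rewrite ij /lam /= flatten_indexKl // leqNgt rk.
  rewrite -(mulKVmx uz v) zE; apply: memv_suml => i _.
  case: (leqP k (lam i)) => ki.
    by have /implyP/(_ ki)/eqP-> := H i; rewrite scale0r mem0v.
  apply/memvZ/memv_span; rewrite /= nth_flatten; apply/flattenP.
  exists (nth [::] B (lam i)).
    by rewrite -(nth_take [::] ki) mem_nth // size_takel ?szB.
  apply: mem_nth; have := reshape_offsetP (sh := shape B) (i := i); rewrite sumB => /(_ (ltn_ord i)).
  by rewrite (nth_map [::]) // szB; exact: lamB.
exists z, lam; split=> //.
  move=> k; rewrite /composition /= -shB; set N := nth _ _ _.
  have fm (c : 'I_N) : (flatten_index (shape B) k c < m)%N by rewrite -[X in (_ < X)%N]sumB; apply: flatten_indexP.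
  rewrite -[RHS]card_ord -(card_imset (f := fun c => Ordinal (fm c))); last first.
    move=> c d /(congr1 (reshape_offset (shape B) \o val)) /=.
    by rewrite !flatten_indexKr // => /val_inj.
  apply: eq_card => i; rewrite inE; apply/eqP/imsetP => [ik|[c _ ->]]; last exact: flatten_indexKl.
  have off : (reshape_offset (shape B) i < N)%N by rewrite /N -ik; apply: reshape_offsetP; rewrite sumB.
  by exists (Ordinal off) => //; apply: val_inj; rewrite /= -ik reshape_indexK.
move=> g; split=> [[ug st]|[ug pg]]; split=> //.
  move=> i j nz; rewrite /lle /= leqNgt; apply: contra nz => ji.
  have js := lamB j; have Fs : nth 0%VS (0%VS :: s) (lam j).+1 \in s by rewrite /= mem_nth.
  have Yj : Y`_j \in nth 0%VS (0%VS :: s) (lam j).+1.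
    rewrite memF //; apply/forallP=> a; apply/implyP; rewrite zY mxE eqxx andbT.
    by case: (eqVneq a j) => [->|_ _]; rewrite ?ltnn ?eqxx.
  have := memv_img (linfun (mulmx g : 'cV_m -> 'cV_m)) Yj; rewrite (st _ Fs) lfunE memF //=.
  move/forallP/(_ i); rewrite ji /=.
  have -> : Y`_j = z *m delta_mx j 0 by rewrite -zY mulKVmx.
  by rewrite !mulmxA -colE mxE.
move=> W Ws; have [k ks ->] : exists2 k, (k <= size s)%N & W = nth 0%VS (0%VS :: s) k.
  by exists (index W s).+1; rewrite ?index_mem //= nth_index.
apply/eqP; rewrite eqEdim limg_dim_eq ?leqnn ?andbT.
  apply/subvP=> _ /memv_imgP[v vk ->]; rewrite lfunE memF //=.
  apply/forallP=> i; apply/implyP=> ki; rewrite -{1}(mulKVmx uz v) !mulmxA -mulmxA mxE.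
  apply/eqP; apply: big1 => j _; move: vk; rewrite memF // => /forallP/(_ j).
  case: (eqVneq ((invmx z *m g *m z) i j) 0) => [->|/pg]; first by rewrite mul0r.
  rewrite /lle /= => ij; rewrite (leq_trans ki ij) /= => /eqP->; exact: mulr0.
suff -> : lker (linfun (mulmx g : 'cV_m -> 'cV_m)) = 0%VS by rewrite capv0.
apply/eqP/lker0P => u v; rewrite !lfunE /= => E.
by rewrite -(mulKmx ug u) E mulKmx.
Qed.
End AdaptedBasis.

Local Open Scope classical_set_scope.

Section Cosets.
Variables (F : fieldType) (m : nat) (R : parabolic F m).
Implicit Types g h : 'M[F]_m.

Lemma stab_unit g : stab R g -> g \in unitmx.
Proof. by case. Qed.

Lemma stab1 : stab R 1%:M.
Proof.
have [z [lam [uz _ stE]]] := adapted_basis R; apply/stE; rewrite unitmx1 mulmx1 mulVmx //.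
by split=> //; apply: pat_scalar.
Qed.

Lemma stabM g h : stab R g -> stab R h -> stab R (g *m h).
Proof.
have [z [lam [uz _ stE]]] := adapted_basis R => /stE[ug pg] /stE[uh ph]; apply/stE.
rewrite unitmx_mul ug uh; split=> //.
have -> : invmx z *m (g *m h) *m z = invmx z *m g *m z *m (invmx z *m h *m z).
  by rewrite !mulmxA mulmxK.
exact: patM pg ph.
Qed.

Lemma stabV g : stab R g -> stab R (invmx g).
Proof.
have [z [lam [uz _ stE]]] := adapted_basis R => /stE[ug pg]; apply/stE.
rewrite unitmx_inv ug; split=> //.
have u1 : invmx z *m g *m z \in unitmx by rewrite !unitmx_mul unitmx_inv uz ug.
have -> : invmx z *m invmx g *m z = invmx (invmx z *m g *m z).
  apply: (can_inj (mulKmx u1)); rewrite mulmxV // !mulmxA mulmxK //.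
  by rewrite -(mulmxA (invmx z)) mulmxV // mulmx1 mulVmx.
exact: pat_inv.
Qed.

Lemma ltransM g h (A : set 'M[F]_m) : ltrans g (ltrans h A) = ltrans (g *m h) A.
Proof.
apply/seteqP; split=> x; first by case=> _ [y Ay <-] <-; exists y; rewrite ?mulmxA.
by case=> y Ay <-; exists (h *m y); [exists y | rewrite mulmxA].
Qed.

Lemma ltrans1 (A : set 'M[F]_m) : ltrans 1%:M A = A.
Proof.
apply/seteqP; split=> x; first by case=> y Ay <-; rewrite mul1mx.
by move=> Ax; exists x; rewrite ?mul1mx.
Qed.

Lemma ltrans_stab g h : h \in unitmx ->
  ltrans g (stab R) = ltrans h (stab R) <-> stab R (invmx h *m g).
Proof.
move=> uh; split=> [E|st].
  have [s ss sE] : ltrans h (stab R) g by rewrite -E; exists 1%:M; [apply: stab1 | rewrite mulmx1].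
  by rewrite -sE mulKmx.
rewrite -{1}(mulKVmx uh g) -ltransM; congr ltrans; apply/seteqP; split=> x.
  by case=> y sy <-; apply: stabM.
move=> sx; exists (invmx (invmx h *m g) *m x); first by apply/stabM: sx; apply: stabV.
by rewrite mulKVmx //; apply: stab_unit st.
Qed.

End Cosets.

Section Translation.
Variables (F : fieldType) (p q : nat).
Variables (P : parabolic F (p + q)) (Q1 : parabolic F p) (Q2 : parabolic F q).
Implicit Types h : 'M[F]_(p + q).
Implicit Types x y : set 'M[F]_p * set 'M[F]_q * set 'M[F]_(p + q).

Lemma KembedM (k1 l1 : 'M[F]_p) (k2 l2 : 'M[F]_q) :
  Kembed (k1, k2) *m Kembed (l1, l2) = Kembed (k1 *m l1, k2 *m l2).
Proof. by rewrite /Kembed mulmx_block /= !mulmx0 !mul0mx !addr0 !add0r. Qed.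

Lemma Kembed1 : Kembed (1%:M, 1%:M) = 1%:M :> 'M[F]_(p + q).
Proof. by rewrite /Kembed -scalar_mx_block. Qed.

Lemma Kembed_unit (k1 : 'M[F]_p) (k2 : 'M[F]_q) : k1 \in unitmx -> k2 \in unitmx ->
  Kembed (k1, k2) \in unitmx.
Proof. by move=> u1 u2; rewrite unitmxE det_lblock unitrM -!unitmxE u1 u2. Qed.

(** K is transitive on the product of the first two flag varieties, so every orbit contains such a
    point; the remaining freedom is that of double cosets of Q1 x Q2 and P in GL_n. *)
Definition basept h := (ltrans 1%:M (stab Q1), ltrans 1%:M (stab Q2), ltrans h (stab P)).

Lemma Korbit_act (k : 'M[F]_p * 'M[F]_q) x : Kgroup p q k -> Korbit (Kact k x) = Korbit x.
Proof.
case: k x => k1 k2 [[x1 x2] x3] [/= u1 u2].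
apply/seteqP; split=> y [[l1 l2] [/= v1 v2] <-].
  exists (l1 *m k1, l2 *m k2); first by split; rewrite /GL /= unitmx_mul; apply/andP.
  by rewrite /Kact /= !ltransM KembedM.
exists (l1 *m invmx k1, l2 *m invmx k2).
  by split; rewrite /GL /= unitmx_mul unitmx_inv; apply/andP.
by rewrite /Kact /= !ltransM KembedM !mulmxKV.
Qed.

Lemma Korbit_refl x : Korbit x x.
Proof.
case: x => [[x1 x2] x3]; exists (1%:M, 1%:M); first by split; rewrite /GL /= unitmx1.
by rewrite /Kact /= Kembed1 !ltrans1.
Qed.

Lemma Korbit_base h h' : h' \in unitmx ->
  Korbit (basept h) = Korbit (basept h') <->
  exists k1 k2, [/\ stab Q1 k1, stab Q2 k2 & stab P (invmx h' *m (Kembed (k1, k2) *m h))].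
Proof.
move=> uh'; split=> [E|[k1 [k2 [s1 s2 s3]]]].
  have := Korbit_refl (basept h'); rewrite -E => -[[k1 k2] _]; rewrite /Kact /basept /=.
  rewrite !ltransM !mulmx1 => -[e1 e2 /(ltrans_stab _ _ uh') e3].
  exists k1, k2; split=> //.
    by move/(ltrans_stab _ _ (unitmx1 _ _)): e1; rewrite invmx1 mul1mx.
  by move/(ltrans_stab _ _ (unitmx1 _ _)): e2; rewrite invmx1 mul1mx.
have -> : basept h' = Kact (k1, k2) (basept h).
  rewrite /Kact /basept /= !ltransM !mulmx1; congr (_, _, _); apply/esym/ltrans_stab;
    by rewrite ?unitmx1 // invmx1 mul1mx.
by rewrite Korbit_act //; split; [case: s1 | case: s2].
Qed.

Lemma Korbit_cover x : double_flag_variety P Q1 Q2 x ->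
  exists2 h, h \in unitmx & Korbit x = Korbit (basept h).
Proof.
case: x => [[x1 x2] x3] [[/= [h1 u1 <-] [h2 u2 <-]] [h uh <-]].
exists (invmx (Kembed (h1, h2)) *m h); first by rewrite unitmx_mul unitmx_inv Kembed_unit.
rewrite -[RHS](@Korbit_act (h1, h2)) //; congr Korbit; rewrite /Kact /basept /= !ltransM !mulmx1.
by rewrite mulKVmx // Kembed_unit.
Qed.

Lemma basept_in h : h \in unitmx -> double_flag_variety P Q1 Q2 (basept h).
Proof.
by move=> uh; split; [split; exists 1%:M; rewrite ?/GL /= ?unitmx1 | exists h].
Qed.

Definition row_label (l1 : 'I_p -> nat) (l2 : 'I_q -> nat) (i : 'I_(p + q)) : label :=
  match split i with inl a => (true, l1 a) | inr b => (false, l2 b) end.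

Lemma pat_block l1 l2 (x : 'M[F]_(p + q)) :
  pat (row_label l1 l2) (row_label l1 l2) x <->
  exists (x1 : 'M_p) (x2 : 'M_q), [/\ pat (fun i => (true, l1 i)) (fun i => (true, l1 i)) x1,
                    pat (fun i => (true, l2 i)) (fun i => (true, l2 i)) x2 & x = Kembed (x1, x2)].
Proof.
have lL a : row_label l1 l2 (lshift q a) = (true, l1 a).
  by rewrite /row_label (unsplitK (inl a)).
have lR b : row_label l1 l2 (rshift p b) = (false, l2 b).
  by rewrite /row_label (unsplitK (inr b)).
split=> [px|[x1 [x2 [p1 p2 ->]]]].
  exists (ulsubmx x), (drsubmx x); split.
  - by move=> i j; rewrite !mxE => /px; rewrite !lL.
  - by move=> i j; rewrite !mxE => /px; rewrite !lR.
  rewrite /Kembed -{1}(submxK x); congr block_mx; apply/matrixP=> i j; rewrite !mxE;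
    by apply/eqP; apply: contraT => /px; rewrite lL lR.
move=> i j; rewrite /Kembed -(splitK i) -(splitK j).
case: (split i) (split j) => [a|a] [b|b] /=; rewrite ?block_mxEul ?block_mxEur ?block_mxEdl ?block_mxEdr.
- by rewrite !lL; apply: p1.
- by rewrite mxE eqxx.
- by rewrite mxE eqxx.
- by rewrite !lR; apply: p2.
Qed.

(** With [D] and [z] the changes to adapted bases, [gam] sends the double coset of [h] to the class
    of D^-1 h z under [eqv r c]. *)
Lemma finite_type_profile : exists r c : 'I_(p + q) -> label,
  profile r c (composition Q1) (composition Q2) (composition P) /\
  (finite_type P Q1 Q2 <-> finitely_many F r c).
Proof.
have [z1 [l1 [u1 n1 st1]]] := adapted_basis Q1.
have [z2 [l2 [u2 n2 st2]]] := adapted_basis Q2.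
have [z [l [uz n3 st3]]] := adapted_basis P.
pose r := row_label l1 l2; pose c i : label := (true, l i); exists r, c; split.
  have cardE k (f : 'I_k -> nat) v : #|[set i | f i == v]%SET| = (\sum_i (f i == v))%N.
    by rewrite -sum1dep_card big_mkcond.
  split=> k.
  - rewrite cntE big_split_ord -n1 cardE /= [X in (_ + X)%N]big1 ?addn0 => [|b _].
      by apply: eq_bigr => a _; rewrite /r /row_label (unsplitK (inl a)).
    by rewrite /r /row_label (unsplitK (inr b)).
  - rewrite cntE big_split_ord -n2 cardE /= [X in (X + _)%N]big1 ?add0n => [|a _].
      by apply: eq_bigr => b _; rewrite /r /row_label (unsplitK (inr b)).
    by rewrite /r /row_label (unsplitK (inl a)).
  - by rewrite cntE -n3 cardE.
  - by rewrite cntE big1.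
pose D := Kembed (z1, z2); have uD : D \in unitmx by apply: Kembed_unit.
have DV : invmx D = Kembed (invmx z1, invmx z2).
  by apply: (can_inj (mulKmx uD)); rewrite mulmxV // KembedM !mulmxV // Kembed1.
pose gam h := invmx D *m h *m z.
have gamU h : h \in unitmx -> gam h \in unitmx by move=> uh; rewrite !unitmx_mul unitmx_inv uD uh.
have eqvE h h' : h \in unitmx -> h' \in unitmx ->
    eqv r c (gam h) (gam h') <-> Korbit (basept h) = Korbit (basept h').
  move=> uh uh'; rewrite Korbit_base //.
  split=> [[x [y [[/pat_block[x1 [x2 [p1 p2 xE]]] py] ux uy E]]]|[k1 [k2 [s1 s2 s3]]]].
    have /andP[ux1 ux2] : (x1 \in unitmx) && (x2 \in unitmx).
      by move: ux; rewrite xE unitmxE det_lblock unitrM -!unitmxE.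
    have KE : Kembed (z1 *m x1 *m invmx z1, z2 *m x2 *m invmx z2) = D *m x *m invmx D.
      by rewrite DV xE !KembedM.
    exists (z1 *m x1 *m invmx z1), (z2 *m x2 *m invmx z2); split.
    - apply/st1; rewrite !unitmx_mul unitmx_inv u1 ux1; split=> //.
      by rewrite !mulmxA mulVmx // mul1mx mulmxKV.
    - apply/st2; rewrite !unitmx_mul unitmx_inv u2 ux2; split=> //.
      by rewrite !mulmxA mulVmx // mul1mx mulmxKV.
    apply/st3; rewrite KE !unitmx_mul !unitmx_inv uD uh uh' ux; split=> //.
    set w := (X in pat _ _ X); suff -> : w = y by [].
    apply: (can_inj (mulKmx (gamU _ uh'))); rewrite -E /gam /w !mulmxA.
    by rewrite mulmxK // mulmxK // mulVmx // mul1mx.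
  have /st1[v1 q1] := s1; have /st2[v2 q2] := s2; have /st3[v3 q3] := s3.
  exists (Kembed (invmx z1 *m k1 *m z1, invmx z2 *m k2 *m z2)).
  exists (invmx z *m (invmx h' *m (Kembed (k1, k2) *m h)) *m z); split.
  - by split=> //; apply/pat_block; do 2!eexists; split; last by [].
  - by apply: Kembed_unit; rewrite !unitmx_mul unitmx_inv ?u1 ?u2 ?v1 ?v2.
  - by rewrite unitmx_mul uz andbT unitmx_mul unitmx_inv uz v3.
  rewrite -!KembedM -DV -/D /gam !mulmxA.
  by rewrite !mulmxK //.
split=> [[n /card_set_bijP[f [ff fi _]]]|[K [inv Hinv]]].
  (* [ung] inverts [gam]; the range is ['I_n.+1] because [inord] needs it nonempty. *)
  pose ung (g : 'M[F]_(p + q)) := D *m g *m invmx z.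
  have ungU g : g \in unitmx -> ung g \in unitmx by move=> ug; rewrite !unitmx_mul unitmx_inv uD ug.
  have ungK g : gam (ung g) = g by rewrite /gam /ung !mulmxA mulVmx // mul1mx mulmxKV.
  have inS g : g \in unitmx ->
      [set Korbit x | x in double_flag_variety P Q1 Q2] (Korbit (basept (ung g))).
    by move=> ug; exists (basept (ung g)) => //; apply/basept_in/ungU.
  exists 'I_n.+1, (fun g => inord (f (Korbit (basept (ung g))))) => g h ug uh.
  have lt g0 : g0 \in unitmx -> (f (Korbit (basept (ung g0))) < n.+1)%N.
    by move=> ug0; apply: ltnW; apply: ff; apply: inS.
  move/(congr1 val); rewrite /= !inordK ?lt // => /fi E.
  by rewrite -(ungK g) -(ungK h); apply/eqvE; rewrite ?ungU //; apply: E; rewrite inE; apply: inS.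
have /choice[O HO] k : exists O, forall h, h \in unitmx -> inv (gam h) = k ->
    Korbit (basept h) = O.
  case: (pselect (exists2 h, h \in unitmx & inv (gam h) = k)) => [[h0 uh0 k0]|nh].
    exists (Korbit (basept h0)) => h uh kh; apply/eqvE => //.
    by apply: Hinv; rewrite ?gamU // kh k0.
  by exists set0 => h uh kh; case: nh; exists h.
apply: (@sub_finite_set _ _ [set O k | k in [set: K]]); last exact/finite_image/finite_finset.
move=> _ [x /Korbit_cover[h uh ->] <-]; exists (inv (gam h)) => //.
by rewrite (HO (inv (gam h)) h).
Qed.

End Translation.

Local Open Scope classical_set_scope.

(** * From parabolic subgroups to compositions *)

Section Classified.
Variables (F : fieldType).

Lemma composition_pos m (R : parabolic F m) : all (leq 1) (composition R).
Proof.
case: R => s /=; rewrite /is_flag /composition => /andP[+ _] /=.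
elim: s 0%VS => //= W s IH U /andP[/andP[UW neUW] /IH ->]; rewrite andbT subn_gt0.
by rewrite ltn_neqAle dimvS // andbT (dimv_leqif_eq UW).
Qed.

Lemma sumn_composition m (R : parabolic F m) : sumn (composition R) = m.
Proof.
case: R => s /=; rewrite /is_flag /composition => /andP[pth /eqP lst] /=.
have tel (U : {vspace 'cV[F]_m}) t : path (@strict_subspace F m) U t ->
    (sumn (pairmap (fun U V => \dim V - \dim U) U t) + \dim U = \dim (last U t))%N.
  elim: t U => //= W t IH U /andP[/andP[UW _] /IH <-].
  by rewrite addnC addnA subnKC ?dimvS // addnC.
by have := tel _ _ pth; rewrite lst dimv0 addn0 => ->; rewrite dimvf /dim /= muln1.
Qed.

Lemma size_composition_gt0 m (R : parabolic F m) : (1 <= m)%N -> (0 < size (composition R))%N.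
Proof. by move=> m1; have := sumn_composition R; case: composition => //= m0; rewrite -m0 in m1. Qed.

(** With two steps or more, the transvection adding a basis vector of step 1 to one of step 0 does
    not preserve the flag. *)
Lemma stab_eq_GL m (R : parabolic F m) : (1 <= m)%N ->
  stab R = GL m <-> size (composition R) = 1%N.
Proof.
move=> m1; have [z [lam [uz n st]]] := adapted_basis R.
split=> [E|s1].
  apply/eqP; rewrite eqn_leq size_composition_gt0 // andbT leqNgt; apply/negP=> s2.
  have ex k : (k < 2)%N -> exists i, lam i = k.
    move=> k2; have : (0 < #|[set i | lam i == k]%SET|)%N.
      by rewrite n; apply: (all_nthP 0%N (composition_pos R)); apply: leq_trans k2 s2.
    by case/card_gt0P=> i; rewrite inE => /eqP; exists i.
  have [[i0 l0] [i1 l1]] := (ex 0%N isT, ex 1%N isT).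
  have ne : i1 == i0 = false by apply/eqP => e; rewrite -e l1 in l0.
  pose x : 'M[F]_m := 1%:M + delta_mx i1 i0.
  have ux : x \in unitmx.
    suff /mulmx1_unit[] : x *m (1%:M - delta_mx i1 i0) = 1%:M by [].
    rewrite mulmxBr mulmx1 mulmxDl mul1mx mul_delta_mx_cond eq_sym ne mulr0n addr0.
    by rewrite addrK.
  have : stab R (z *m x *m invmx z) by rewrite E /GL /= !unitmx_mul unitmx_inv uz ux.
  case/st=> _ /(_ i1 i0); rewrite !mulmxA mulVmx // mul1mx mulmxKV // /x !mxE !eqxx ne add0r oner_eq0.
  by move/(_ isT); rewrite /lle /= l0 l1.
apply/seteqP; split=> g; first by case.
rewrite /GL /= => ug; apply/st; split=> // i j _.
have lam0 a : lam a = 0%N.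
  have : (0 < #|[set i | lam i == lam a]%SET|)%N by apply/card_gt0P; exists a; rewrite inE.
  by rewrite n; case: (lam a) => // k; rewrite nth_default // s1.
by rewrite /lle /= !lam0.
Qed.

Lemma stab_prod_eq p q (Q1 : parabolic F p) (Q2 : parabolic F q) :
  stab Q1 `*` stab Q2 = Kgroup p q <-> stab Q1 = GL p /\ stab Q2 = GL q.
Proof.
split=> [E|[E1 E2]]; last by rewrite /Kgroup E1 E2.
have H g h : GL p g -> GL q h -> stab Q1 g /\ stab Q2 h.
  by move=> ug uh; have : Kgroup p q (g, h) by []; rewrite -E.
split; apply/seteqP; split=> g; try by case.
  by move=> ug; have [] := H g 1%:M ug; rewrite /GL /= ?unitmx1.
by move=> ug; have [] := H 1%:M g _ ug; rewrite /GL /= ?unitmx1.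
Qed.

Lemma bigminP (s : seq nat) d : let b := \big[minn/d]_(c <- s) c in
  b \in d :: s /\ forall c, c \in d :: s -> (b <= c)%N.
Proof.
elim: s => [|x s [IH1 IH2]] /=.
  by rewrite big_nil; split=> [|c]; rewrite inE // => /eqP->.
rewrite big_cons; set b := \big[_/_]_(_ <- _) _ in IH1 IH2 *; split.
  move: IH1; rewrite /minn !inE; case: ltnP => _; first by rewrite eqxx orbT.
  by case/orP=> ->; rewrite ?orbT.
move=> c; rewrite !inE => /or3P[/eqP->|/eqP->|cs].
- by rewrite geq_min IH2 ?orbT // mem_head.
- by rewrite geq_min leqnn.
- by rewrite geq_min IH2 ?orbT // inE cs orbT.
Qed.

Lemma min_partP m (R : parabolic F m) : (1 <= m)%N ->
  min_part R \in composition R /\ forall c, c \in composition R -> (min_part R <= c)%N.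
Proof.
move=> /(size_composition_gt0 R); rewrite /min_part.
case: (composition R) => //= x s _; have [b1 b2] := bigminP (x :: s) x; split.
  by move: b1; rewrite inE => /orP[/eqP->|//]; rewrite mem_head.
by move=> c cs; apply: b2; rewrite inE cs orbT.
Qed.

Lemma classified_list n p q (P : parabolic F n) (Q1 : parabolic F p) (Q2 : parabolic F q) :
  (1 <= n)%N -> (1 <= p)%N -> (1 <= q)%N ->
  classified P Q1 Q2 <-> finite_list (composition Q1) (composition Q2) (composition P).
Proof.
move=> n1 p1 q1; have [m1 m2] := min_partP P n1.
have G1 := stab_eq_GL Q1 p1; have G2 := stab_eq_GL Q2 q1; have G12 := stab_prod_eq Q1 Q2.
have S1 := sumn_composition Q1; have S2 := sumn_composition Q2.
have min1 : (1 \in composition P) -> min_part P = 1%N.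
  move=> /m2 le; apply/eqP; rewrite eqn_leq le.
  exact: (allP (composition_pos P)).
split.
- case; rewrite /nparts /maximal_parabolic.
  + case=> [/G12[/G1 ? /G2 ?]|[[[? ?] /G2 ?]|[/G1 ? [? ?]]]].
    * exact: fin_11.
    * exact: fin_mir1.
    * exact: fin_mir2.
  + by move=> /G2 ? ?; apply: fin_b1; rewrite ?S2.
  + by move=> ? /G2 ? ?; apply: fin_max_b2; rewrite ?S2.
  + by move=> ? ? /G2 ?; apply: fin_6.
  + by move=> ? ? /G2 ?; apply: fin_4_4.
  + by move=> ? E /G2 ?; apply: fin_4_min; rewrite // -E.
  + by move=> ? /G2 ? ?; apply: fin_4_b2; rewrite ?S2.
  + by move=> ? E; apply: fin_3_min1; rewrite // -E.
  + by move=> ? E ?; apply: fin_3_min2; rewrite // -E.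
  + by move=> ? [/G2 ?|[? ?]]; apply: fin_3_b => //; [left | right].
  + by move=> ? ? ?; apply: fin_3_4_2.
  + by move=> ?; apply: fin_2.
- case; rewrite ?S2.
  + by move=> /G1 ? /G2 ?; apply: PA_1; left; apply/G12.
  + by move=> ? ? /G2 ?; apply: PA_1; right; left.
  + by move=> /G1 ? ? ?; apply: PA_1; right; right.
  + by move=> /G2 ? ?; apply: PA_2.
  + by move=> ? /G2 ? ?; apply: PA_3.
  + by move=> ? ? /G2 ?; apply: P6.
  + by move=> ? ? /G2 ?; apply: P4_1.
  + by move=> ? /min1 ? /G2 ?; apply: P4_2.
  + by move=> ? /G2 ? ?; apply: P4_3.
  + by move=> ? /min1 ?; apply: P3_1.
  (* A part 2 does not exclude a part 1; if 1 occurs, the case is [P3_1]. *)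
  + move=> c3 c2 b2; case: (boolP (1%N \in composition P)) => [/min1|n1']; first exact: P3_1.
    apply: P3_2 => //; apply/eqP; rewrite eqn_leq m2 //= ltn_neqAle.
    rewrite (allP (composition_pos P)) ?m1 // andbT.
    by apply: contraNneq n1' => ->.
  + by move=> ? [/G2 ?|[? ?]]; apply: P3_3 => //; [left | right].
  + by move=> ? ? ?; apply: P3_4.
  + by move=> ?; apply: Defs.P2.
Qed.

End Classified.

Theorem corollary8p6 (R : realType) (p q : nat) (p_ge1 : (1 <= p)%N)
    (q_ge1 : (1 <= q)%N) (P : parabolic R[i] (p + q))
    (Q1 : parabolic R[i] p) (Q2 : parabolic R[i] q) :
  finite_type P Q1 Q2 <-> classified P Q1 Q2 \/ classified P Q2 Q1.
Proof.
have n_ge1 : (1 <= p + q)%N by apply: leq_trans p_ge1 (leq_addr _ _).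
rewrite !classified_list //; have [r [c [prof ->]]] := finite_type_profile P Q1 Q2.
(* The profile fixes the order of Q1 and Q2, while the Tits form is symmetric in them. *)
have swap : positive_form (composition Q2) (composition Q1) (composition P) ->
    positive_form (composition Q1) (composition Q2) (composition P).
  move=> pos a b d ba bb bd; rewrite addnC => E d0.
  by rewrite (mulnC (sumn a)) (addnC (sq a)); apply: pos.
split=> [fin|[]/positive_of_list pos].
- have := finite_list_or_negative (size_composition_gt0 Q1 p_ge1) (size_composition_gt0 Q2 q_ge1)
    (composition_pos Q1) (composition_pos Q2) (composition_pos P).
  case=> [?|?|neg]; [by left | by right |].
  by case: (infinite_of_negative prof neg fin).
- exact/finitely_many_of_qpos/(qpos_of_positive prof).
- exact/finitely_many_of_qpos/(qpos_of_positive prof)/swap.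
Qed.
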